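(* Let $R$ be an associative ring with unit and let $n>1$ be an integer. The following are equivalent. (1) $R$ is a left $n$-hereditary ring. (2) $\mathcal{FP}_n\text{-}\mathrm{Inj}$ is a $1$-tilting class in the category of left $R$-modules. (3) $\mathcal{FP}_n\text{-}\mathrm{Flat}$ is a $1$-cotilting class in the category of right $R$-modules.
   Context: For an integer $n\ge 0$, a left $R$-module $F$ is finitely $n$-presented if there is an exact sequence $F_n\to F_{n-1}\to\cdots\to F_0\to F\to 0$ with each $F_i$ a finitely generated free (equivalently projective) left module; $\mathcal{FP}_n$ is the class of all such left modules. $R$ is left $n$-hereditary if every submodule belonging to $\mathcal{FP}_{n-1}$ of a finitely generated projective left module is projective. $\mathcal{FP}_n\text{-}\mathrm{Inj}$ is the class of left modules $M$ with $\mathrm{Ext}^1_R(F,M)=0$ for all $F\in\mathcal{FP}_n$; $\mathcal{FP}_n\text{-}\mathrm{Flat}$ is the class of right modules $M$ with $\mathrm{Tor}_1^R(M,F)=0$ for all $F\in\mathcal{FP}_n$. A module $T$ is $1$-tilting if: its projective dimension is at most $1$; $\mathrm{Ext}^i_R(T,T^{(J)})=0$ for every $i\ge 1$ and every set $J$ (where $T^{(J)}$ is the direct sum of copies of $T$); and there is an exact sequence $0\to R\to T_0\to T_1\to 0$ with $T_0,T_1$ isomorphic to direct summands of direct sums of copies of $T$. A module $C$ is $1$-cotilting if: its injective dimension is at most $1$; $\mathrm{Ext}^i_R(C^J,C)=0$ for every $i\ge 1$ and every set $J$ (where $C^J$ is the direct product of copies of $C$); and there are an injective cogenerator $Q$ and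 an exact sequence $0\to C_1\to C_0\to Q\to 0$ with $C_0,C_1$ isomorphic to direct summands of direct products of copies of $C$. These definitions are used for left and for right modules. A class $\mathcal{C}$ of modules is a $1$-tilting class if $\mathcal{C}=\mathrm{Ker}(\mathrm{Ext}^1_R(T,-))=\{X:\mathrm{Ext}^1_R(T,X)=0\}$ for some $1$-tilting module $T$, and a $1$-cotilting class if $\mathcal{C}=\mathrm{Ker}(\mathrm{Ext}^1_R(-,C))=\{X:\mathrm{Ext}^1_R(X,C)=0\}$ for some $1$-cotilting module $C$. *)

(* Defs.v *)
From HB Require Import structures.
From mathcomp Require Import all_boot all_order all_algebra.
From mathcomp Require Import generic_quotient ring_quotient.
From mathcomp Require Import finmap.
From mathcomp Require Import boolp classical_sets functions cardinality fsbigop.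
From mathcomp Require Import freeg.

Set Implicit Arguments.
Unset Strict Implicit.
Unset Printing Implicit Defensive.

Import GRing.Theory.
Local Open Scope ring_scope.

(* Left modules over R are the [lmodType R]s and right modules over R are the
   [lmodType R^c]s, m r being (r : R^c) *: m.  Every notion below is stated
   for left modules over an arbitrary ring; its version for right modules is
   the instance at R^c.  [pzRingType] does not exclude the zero ring. *)

Definition surj (A B : Type) (f : A -> B) := forall y, exists x, f x = y.

Definition exact_at (A B C : zmodType) (f : A -> B) (g : B -> C) :=
  forall y, g y = 0 <-> exists x, f x = y.

Definition short_exact (A B C : zmodType) (f : A -> B) (g : B -> C) :=
  [/\ injective f, exact_at f g & surj g].

Section DirectSum.
Variables (R : pzRingType) (J : Type) (T : lmodType R).

Definition fin_supp : {pred J -> T} :=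
  [pred f : J -> T | `[< finite_set [set j | f j <> 0] >]].

Lemma fin_suppP f : reflect (finite_set [set j | f j <> 0]) (f \in fin_supp).
Proof. exact: asboolP. Qed.

Lemma fin_supp_submod_closed : submod_closed fin_supp.
Proof.
split=> [|a f g /fin_suppP finf /fin_suppP fing]; apply/fin_suppP.
  by apply: (@sub_finite_set _ _ set0) => // j /=.
apply: (@sub_finite_set _ _ ([set j | f j <> 0] `|` [set j | g j <> 0])%classic).
  move=> j /= fgj; apply: contrapT => /not_orP[] /contrapT fj /contrapT gj.
  by apply: fgj; rewrite !fctE fj gj scaler0 addr0.
by rewrite finite_setU.
Qed.

HB.instance Definition _ :=
  GRing.isSubmodClosed.Build R (J -> T) fin_supp fin_supp_submod_closed.

(* T^(J), the functions J -> T of finite support; T^J is the type J -> T. *)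
Record dsum := DSum { dsum_val :> J -> T; _ : dsum_val \in fin_supp }.

HB.instance Definition _ := [isSub for dsum_val].
HB.instance Definition _ := [Choice of dsum by <:].
HB.instance Definition _ := [SubChoice_isSubZmodule of dsum by <:].
HB.instance Definition _ := [SubZmodule_isSubLmodule of dsum by <:].
End DirectSum.

Section Modules.
Variable R : pzRingType.
Implicit Types A B C F M P Q T X : lmodType R.

Definition projective P :=
  forall A B (q : {linear A -> B}) (f : {linear P -> B}), surj q ->
  exists g : {linear P -> A}, forall x, q (g x) = f x.

Definition injective_module Q :=
  forall A B (i : {linear A -> B}) (f : {linear A -> Q}), injective i ->
  exists g : {linear B -> Q}, forall x, g (i x) = f x.

Definition cogenerator Q :=
  forall A B (f : {linear A -> B}), (exists x, f x <> 0) ->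
  exists (h : {linear B -> Q}) x, h (f x) <> 0.

Definition finitely_generated M :=
  exists (k : nat) (q : {linear 'rV[R]_k -> M}), surj q.

(* Only the modules F_i = R^(k i) with i <= n matter; the sequence is exact at
   M, at F_0 (if n >= 1), ..., at F_(n-1), and nothing is asked at F_n. *)
Definition fin_presented (n : nat) M :=
  exists (k : nat -> nat) (e : {linear 'rV[R]_(k 0%N) -> M})
         (d : forall i, {linear 'rV[R]_(k i.+1) -> 'rV[R]_(k i)}),
  [/\ surj e, (0 < n)%N -> exact_at (d 0%N) e &
      forall i, (i.+1 < n)%N -> exact_at (d i.+1) (d i)].

(* A submodule of P is given as a module S with an injective linear map. *)
Definition left_n_hereditary (n : nat) :=
  forall (P S : lmodType R) (i : {linear S -> P}),
  projective P -> finitely_generated P -> injective i ->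
  fin_presented n.-1 S -> projective S.

Record proj_resolution A := ProjResolution {
  res_mod :> nat -> lmodType R;
  res_d : forall k, {linear res_mod k.+1 -> res_mod k};
  res_aug : {linear res_mod 0%N -> A};
  res_projective : forall k, projective (res_mod k);
  res_aug_surj : surj res_aug;
  res_exact0 : exact_at (res_d 0%N) res_aug;
  res_exact : forall k, exact_at (res_d k.+1) (res_d k) }.

(* Ext^i_R(A, B) = 0: the complex Hom_R(P, B) has no cohomology in degree i.
   This does not depend on the projective resolution P of A, and every module
   has one (proj_resolution_exists). *)
Definition Ext_eq0 (i : nat) A B :=
  forall P : proj_resolution A,
  match i with
  | 0 => forall f : {linear P 0%N -> B},
      (forall x, f (res_d P 0%N x) = 0) -> forall x, f x = 0
  | k.+1 => forall f : {linear P k.+1 -> B},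
      (forall x, f (res_d P k.+1 x) = 0) ->
      exists g : {linear P k -> B}, forall x, f x = g (res_d P k x)
  end.

Definition pdim_le1 T :=
  exists (P1 P0 : lmodType R) (f : {linear P1 -> P0}) (g : {linear P0 -> T}),
  [/\ projective P1, projective P0 & short_exact f g].

Definition idim_le1 C :=
  exists (I0 I1 : lmodType R) (f : {linear C -> I0}) (g : {linear I0 -> I1}),
  [/\ injective_module I0, injective_module I1 & short_exact f g].

Definition is_summand A B :=
  exists (K : lmodType R) (f : {linear (A * K)%type -> B}), bijective f.

Definition in_Add T A := exists J : Type, is_summand A (dsum J T).
Definition in_Prod C A := exists J : Type, is_summand A (J -> C).

Definition tilting T :=
  [/\ pdim_le1 T,
      forall (i : nat) (J : Type), (0 < i)%N -> Ext_eq0 i T (dsum J T) &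
      exists (T0 T1 : lmodType R) (f : {linear R^o -> T0}) (g : {linear T0 -> T1}),
      [/\ short_exact f g, in_Add T T0 & in_Add T T1]].

Definition cotilting C :=
  [/\ idim_le1 C,
      forall (i : nat) (J : Type), (0 < i)%N -> Ext_eq0 i (J -> C) C &
      exists (Q C1 C0 : lmodType R) (f : {linear C1 -> C0}) (g : {linear C0 -> Q}),
      [/\ injective_module Q, cogenerator Q, short_exact f g,
          in_Prod C C0 & in_Prod C C1]].

Definition tilting_class (K : lmodType R -> Prop) :=
  exists T, tilting T /\ forall X, K X <-> Ext_eq0 1 T X.

Definition cotilting_class (K : lmodType R -> Prop) :=
  exists C, cotilting C /\ forall X, K X <-> Ext_eq0 1 X C.

Definition FP_Inj (n : nat) M := forall F, fin_presented n F -> Ext_eq0 1 F M.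

End Modules.

Section FreeResolution.
Variable R : pzRingType.

Definition dsum_lift (J : choiceType) (V : lmodType R) (phi : J -> V)
    (a : dsum J R^o) : V :=
  \sum_(j \in [set: J]) (a j : R) *: phi j.

Lemma dsum_supp (J : choiceType) (a : dsum J R^o) :
  finite_set [set j | a j <> 0].
Proof. by case: a => a /= /fin_suppP. Qed.

Lemma dsum_liftE (J : choiceType) (V : lmodType R) (phi : J -> V) (D : set J)
    (a : dsum J R^o) : finite_set D -> ([set j | a j <> 0] `<=` D)%classic ->
  dsum_lift phi a = \sum_(j <- fset_set D) (a j : R) *: phi j.
Proof.
move=> finD aD; rewrite -fsbig_finite //; apply/esym/fsbig_widen => // j [_ /= Dj].
by have [->|/eqP/aD//] := eqVneq (a j) 0; rewrite scale0r.
Qed.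

Lemma dsum_lift_linear (J : choiceType) (V : lmodType R) (phi : J -> V) :
  linear (@dsum_lift J V phi).
Proof.
move=> c a b; have finU : finite_set
    ([set j | a j <> 0] `|` [set j | b j <> 0])%classic.
  by rewrite finite_setU; split; apply: dsum_supp.
rewrite !(dsum_liftE phi finU).
- rewrite scaler_sumr -big_split; apply: eq_bigr => j _ /=.
  by rewrite !fctE scalerDl scalerA.
- by move=> j; right.
- by move=> j; left.
move=> j /= abj; apply: contrapT => /not_orP[] /contrapT aj /contrapT bj.
by apply: abj; rewrite !fctE aj bj scaler0 addr0.
Qed.

HB.instance Definition _ (J : choiceType) (V : lmodType R) (phi : J -> V) :=
  GRing.isLinear.Build R (dsum J R^o) V *:%R (dsum_lift phi)
    (dsum_lift_linear phi).

Definition dsum_unit_fun (J : choiceType) (j : J) : J -> R^o :=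
  fun i => (i == j)%:R.

Lemma dsum_unit_proof (J : choiceType) (j : J) :
  dsum_unit_fun j \in @fin_supp R J R^o.
Proof.
apply/fin_suppP; apply: (@sub_finite_set _ _ [set j]%classic) => // i /=.
by rewrite /dsum_unit_fun; case: eqP.
Qed.

Definition dsum_unit (J : choiceType) (j : J) : dsum J R^o :=
  DSum (dsum_unit_proof j).

Lemma dsum_lift_unit (J : choiceType) (V : lmodType R) (phi : J -> V) j :
  dsum_lift phi (dsum_unit j) = phi j.
Proof.
rewrite (@dsum_liftE _ _ _ [set j]%classic) //.
  by rewrite fset_set1 big_seq_fset1 /= /dsum_unit_fun eqxx scale1r.
by move=> i /=; rewrite /dsum_unit_fun; case: eqP.
Qed.

Lemma dsum_lift_eta (J : choiceType) (a : dsum J R^o) :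
  dsum_lift (@dsum_unit J) a = a.
Proof.
apply/val_inj/funext => i /=.
rewrite (dsum_liftE _ (dsum_supp a)) //.
rewrite (big_morph (fun b : dsum J R^o => b i) (id1 := 0) (op1 := +%R)) //=.
rewrite (eq_bigr (fun j => (a j : R) * (i == j)%:R)) //.
case: (boolP (i \in fset_set [set j | a j <> 0]%classic)) => [ia|ia].
  rewrite (big_fsetD1 i) //= eqxx mulr1 big_seq big1 ?addr0 // => j.
  by rewrite in_fsetD1 eq_sym => /andP[/negPf-> _]; rewrite mulr0.
rewrite big_seq big1 => [|j ja]; last first.
  by case: eqP ja ia => [<- ->//|]; rewrite mulr0.
move: ia; rewrite in_fset_set; last exact: dsum_supp.
by rewrite notin_setE /= => /contrapT ->.
Qed.

Lemma dsum_projective (J : choiceType) : projective (dsum J R^o).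
Proof.
move=> A B q f q_surj.
have /choice[s sP] : forall j, exists a, q a = f (dsum_unit j).
  by move=> j; apply: q_surj.
exists (dsum_lift s) => a /=.
rewrite -[in RHS](dsum_lift_eta a) !(dsum_liftE _ (dsum_supp a)) // !linear_sum.
by apply: eq_bigr => j _; rewrite !linearZ /= sP.
Qed.

Section Kernel.
Variables (A B : lmodType R) (f : {linear A -> B}).

Definition lin_ker : {pred A} := [pred x | f x == 0].

Lemma lin_ker_submod_closed : submod_closed lin_ker.
Proof.
split=> [|a x y]; rewrite !inE ?linear0 // => /eqP fx /eqP fy.
by rewrite linearP fx fy scaler0 addr0.
Qed.

HB.instance Definition _ :=
  GRing.isSubmodClosed.Build R A lin_ker lin_ker_submod_closed.

Record ker_of := KerOf { ker_val :> A; _ : ker_val \in lin_ker }.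

HB.instance Definition _ := [isSub for ker_val].
HB.instance Definition _ := [Choice of ker_of by <:].
HB.instance Definition _ := [SubChoice_isSubZmodule of ker_of by <:].
HB.instance Definition _ := [SubZmodule_isSubLmodule of ker_of by <:].
End Kernel.

Definition free_cover (A : lmodType R) : {linear dsum A R^o -> A} :=
  dsum_lift (@id A).

Lemma free_cover_surj (A : lmodType R) : surj (free_cover A).
Proof. by move=> x; exists (dsum_unit x); apply: dsum_lift_unit. Qed.

Fixpoint syzygy (A : lmodType R) (k : nat) : lmodType R :=
  if k is k'.+1 then ker_of (free_cover (syzygy A k')) else A.

Definition free_res_d (A : lmodType R) (k : nat) :
    {linear dsum (syzygy A k.+1) R^o -> dsum (syzygy A k) R^o} :=
  (val : {linear ker_of (free_cover (syzygy A k)) -> _}) \o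
    free_cover (syzygy A k.+1).

Lemma free_res_exact (A B : lmodType R) (f : {linear A -> B}) :
  exact_at ((val : {linear ker_of f -> A}) \o free_cover (ker_of f)) f.
Proof.
move=> y; split=> [fy0|[x <-]]; last by apply/eqP/(valP (free_cover _ x)).
have fy : y \in lin_ker f by apply/eqP.
by have [x xy] := free_cover_surj (KerOf fy); exists x; rewrite /= xy.
Qed.

Lemma proj_resolution_exists (A : lmodType R) : inhabited (proj_resolution A).
Proof.
apply: inhabits.
apply: (@ProjResolution _ A (fun k => dsum (syzygy A k) R^o) (free_res_d A)
          (free_cover A)).
- by move=> k; apply: dsum_projective.
- exact: free_cover_surj.
- exact: free_res_exact.
move=> k y; split=> [y0|[x <-]].
  by apply/(free_res_exact (free_cover (syzygy A k.+1))); apply: val_inj.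
have /(free_res_exact (free_cover (syzygy A k.+1))) xe :
  exists x', free_res_d A k.+1 x' = free_res_d A k.+1 x by exists x.
by rewrite [LHS]/= xe.
Qed.
End FreeResolution.

HB.instance Definition _ (S : nzRingType) (M : lmodType S) (K : choiceType)
    (f : K -> M) :=
  GRing.isZmodMorphism.Build {freeg K / S} M (fglift f) (lift_is_additive f).

Section Tensor.
Variables (R : pzRingType) (M : lmodType R^c).
Implicit Types F G : lmodType R.

Definition balanced_relator F (z : {freeg (M * F)%type / int}) : Prop :=
  [\/ exists m m' x, z = << (m + m', x) >> - << (m, x) >> - << (m', x) >>,
      exists m x x', z = << (m, x + x') >> - << (m, x) >> - << (m, x') >> |
      exists m (r : R) x,
        z = << ((r : R^c) *: m, x) >> - << (m, r *: x) >>].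

(* The subgroup generated by the balanced relators. *)
Definition tensor_rel F : {pred {freeg (M * F)%type / int}} :=
  [pred z | `[< forall S : {pred {freeg (M * F)%type / int}}, zmod_closed S ->
      (forall y, balanced_relator y -> y \in S) -> z \in S >]].

Lemma tensor_rel_zmod_closed F : zmod_closed (@tensor_rel F).
Proof.
split=> [|x y /asboolP xS /asboolP yS]; apply/asboolP => S clS relS.
  by have [] := clS.
by apply: clS.2; [apply: xS | apply: yS].
Qed.

HB.instance Definition _ F :=
  GRing.isZmodClosed.Build {freeg (M * F)%type / int} (@tensor_rel F)
    (@tensor_rel_zmod_closed F).

Definition tensor F : zmodType := Quotient.quot (@tensor_rel F).

Definition tens F (m : M) (x : F) : tensor F :=
  (\pi_(Quotient.quot (@tensor_rel F)) << (m, x) >>)%qT.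

(* M (x) f, computed on a representative of t; tensor_map_pi shows that the
   choice does not matter. *)
Definition tensor_map F G (f : {linear F -> G}) (t : tensor F) : tensor G :=
  (\pi_(Quotient.quot (@tensor_rel G))
     (fglift (fun z : M * F => << (z.1, f z.2) >>) (repr t)))%qT.

Lemma tensor_eq F (a b : {freeg (M * F)%type / int}) :
  (\pi_(Quotient.quot (@tensor_rel F)) a
     = \pi_(Quotient.quot (@tensor_rel F)) b)%qT <-> a - b \in @tensor_rel F.
Proof. by rewrite Quotient.idealrBE; split => /eqP. Qed.

Lemma tensor_map_pi F G (f : {linear F -> G}) (a : {freeg (M * F)%type / int}) :
  tensor_map f (\pi_(Quotient.quot (@tensor_rel F)) a)%qT =
  (\pi_(Quotient.quot (@tensor_rel G))
     (fglift (fun z : M * F => << (z.1, f z.2) >>) a))%qT.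
Proof.
apply/tensor_eq; rewrite -raddfB.
have /tensor_eq : (\pi_(Quotient.quot (@tensor_rel F))
  (repr (\pi_(Quotient.quot (@tensor_rel F)) a))
  = \pi_(Quotient.quot (@tensor_rel F)) a)%qT by rewrite reprK.
move: (_ - a) => b /asboolP b_rel; apply/asboolP => S clS relS.
pose g := fglift (fun z : M * F => << (z.1, f z.2) >> : {freeg (M * G)%type / int}).
apply: (b_rel [pred z | g z \in S]).
  split=> [|x y]; rewrite !inE /g ?raddf0 ?raddfB; last exact: clS.2.
  by have [] := clS.
move=> y [[m [m' [x ->]]]|[m [x [x' ->]]]|[m [r [x ->]]]];
  rewrite inE /g !raddfB /= !liftU !scale1r /= ?raddfD ?linearZ; apply: relS.
- by apply: Or31; exists m, m', (f x).
- by apply: Or32; exists m, (f x), (f x').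
- by apply: Or33; exists m, r, (f x).
Qed.

Lemma tensor_mapD F G (f : {linear F -> G}) : {morph tensor_map f : s t / s + t}.
Proof.
move=> s t; rewrite -[s]reprK -[t]reprK -raddfD !tensor_map_pi.
by rewrite !raddfD.
Qed.

Lemma tensor_map_tens F G (f : {linear F -> G}) m x :
  tensor_map f (tens m x) = tens m (f x).
Proof. by rewrite /tens tensor_map_pi liftU scale1r. Qed.

End Tensor.

(* Tor_i^R(M, F) = 0: the complex M (x)_R P has no homology in degree i, for P
   a projective resolution of F. *)
Definition Tor_eq0 (R : pzRingType) (i : nat) (M : lmodType R^c) (F : lmodType R) :=
  forall P : proj_resolution F,
  match i with
  | 0 => surj (tensor_map (M := M) (res_d P 0%N))
  | k.+1 => exact_at (tensor_map (M := M) (res_d P k.+1))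
                     (tensor_map (M := M) (res_d P k))
  end.

Definition FP_Flat (R : pzRingType) (n : nat) (M : lmodType R^c) :=
  forall F : lmodType R, fin_presented n F -> Tor_eq0 1 M F.

(* Main.v *)
From HB Require Import structures.
From mathcomp Require Import all_boot all_order all_algebra.
From mathcomp Require Import generic_quotient ring_quotient.
From mathcomp Require Import finmap.
From mathcomp Require Import boolp classical_sets functions cardinality fsbigop.
From mathcomp Require Import freeg.
Require Import Defs.

(* Write M^+ for the character module Hom_Z(M, Q/Z).  Since n > 1, modules F in
   FP_n begin with R^b -> R^a -> R^m -> F -> 0, so X is in FP_n-Inj when each
   complex X^m -> X^a -> X^b given by these matrices is exact in the middle, and
   M is in FP_n-Flat when the transposed complexes M^b -> M^a -> M^m are.
   Dualizing exactness exchanges the two conditions.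

   (1) => (2): heredity makes the image of R^a -> R^m projective, so that
   FP_n-Inj is closed under quotients, finite products and direct sums.  Freely
   adjoining to R the solutions of all these systems gives 0 -> R -> T0 -> T1 -> 0
   with T0 in FP_n-Inj and Ext^1(T0, X) = Ext^1(T1, X) = 0 for X in FP_n-Inj;
   T0 x T1 is tilting, and a module X in its Ext-orthogonal class inherits the
   solvability of these systems from T0, as every R -> X extends to T0.

   (2) => (3): if T is tilting then T^+ is cotilting, and Ext^1(M, T^+) and
   Ext^1(T, M^+) vanish simultaneously.

   (3) => (1): FP_n-Flat is closed under submodules.  If S is a submodule of R^m
   with relation matrix D, flatness of the column module of D gives D = D Y D,
   so the kernel of R^a -> S is a direct summand. *)

Set Implicit Arguments.
Unset Strict Implicit.
Unset Printing Implicit Defensive.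

Import Order.TTheory GRing.Theory Num.Theory.
Local Open Scope ring_scope.

(** * Characters with values in Q/Z *)

(** Most maps are built inside proofs, where no global instance can be declared; this and
    [to_linear] bundle them on the spot. *)
Definition to_additive (A B : zmodType) (f : A -> B) (fB : zmod_morphism f) :
    {additive A -> B} :=
  let fB' := GRing.isZmodMorphism.Build A B f fB in
  HB.pack_for {additive A -> B} f fB'.

Definition to_linear (R : pzRingType) (A B : lmodType R) (f : A -> B)
    (fL : linear f) : {linear A -> B} :=
  let fL' := GRing.isLinear.Build R A B *:%R f fL in
  HB.pack_for {linear A -> B} f fL'.

Definition rat_int : {pred rat} := [pred x | x \is a Num.int].

Lemma rat_int_zmod_closed : zmod_closed rat_int.
Proof. by split=> [|x y]; [apply: rpred0 | apply: rpredB]. Qed.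

HB.instance Definition _ :=
  GRing.isZmodClosed.Build rat rat_int rat_int_zmod_closed.

Definition QZ : zmodType := Quotient.quot rat_int.
Definition to_QZ (x : rat) : QZ := (\pi_(Quotient.quot rat_int) x)%qT.

Lemma to_QZ_zmod_morphism : zmod_morphism to_QZ.
Proof. by move=> x y; rewrite /to_QZ raddfB. Qed.

HB.instance Definition _ :=
  GRing.isZmodMorphism.Build rat QZ to_QZ to_QZ_zmod_morphism.

Lemma to_QZ_eq0 x : (to_QZ x == 0) = (x \is a Num.int).
Proof.
by rewrite -(raddf0 to_QZ) /to_QZ -[x in RHS]subr0 -Quotient.idealrBE.
Qed.

Lemma QZ_divisible (q : QZ) (n : nat) : (0 < n)%N -> exists p : QZ, p *+ n = q.
Proof.
move=> n0; elim/quotW: q => x; exists (to_QZ (x / n%:R)).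
rewrite -raddfMn -[(x / _) *+ n]mulr_natr divfK //.
by rewrite pnatr_eq0 -lt0n.
Qed.

(** Take the class of 1/n. It gives a character a nonzero value at an element of order n modulo a
    subgroup. *)
Lemma QZ_order (n : nat) : (1 < n)%N ->
  exists2 q : QZ, q <> 0 & q *+ n = 0.
Proof.
move=> n1; have n0 : (n%:R : rat) != 0 by rewrite pnatr_eq0 -lt0n ltnW.
exists (to_QZ n%:R^-1); last first.
  apply/eqP; rewrite -raddfMn to_QZ_eq0 -[_^-1 *+ n]mulr_natr mulVf //.
move/eqP; rewrite to_QZ_eq0 => /intrP[m mE].
have : (n%:R : rat) * m%:~R = 1 by rewrite -mE mulfV.
have -> : (n%:R : rat) = n%:Z%:~R by [].
rewrite -intrM => /eqP; rewrite -[1]/(1%:~R) eqr_int => /eqP nm1.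
have : (n%:Z %| 1)%Z by apply/dvdzP; exists m; rewrite mulrC nm1.
by rewrite dvdzE /= dvdn1 => /eqP n1E; rewrite n1E in n1.
Qed.

Lemma mulrz_modz (V : zmodType) (x : V) (m : int) (d : nat) :
  x *~ (m %% d)%Z = x *~ m - x *+ d *~ (m %/ d)%Z.
Proof.
have -> : x *~ m = x *+ d *~ (m %/ d)%Z + x *~ (m %% d)%Z.
  by rewrite pmulrn -mulrzA (mulrC d%:Z) -mulrzDr -divz_eq.
by rewrite addrC addKr.
Qed.

Section ExtendCharacter.
Variable B : zmodType.
Implicit Types G : set (B * QZ).

(** The graph of a homomorphism from a subgroup of [B] to Q/Z, or the empty set. Encoded as graphs,
    partial characters extend one another by inclusion and a chain is bounded by its union. *)
Definition partial_character G :=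
  (forall x y, G x -> G y -> G (x - y)) /\ (forall q, G (0, q) -> q = 0).

Section PartialCharacter.
Variable G : set (B * QZ).
Hypothesis Gpart : partial_character G.

Lemma partial_character0 x : G x -> G 0.
Proof. by move=> Gx; rewrite -(subrr x); apply: Gpart.1. Qed.

Lemma partial_characterN x : G x -> G (- x).
Proof.
by move=> Gx; rewrite -sub0r; apply: Gpart.1 => //; apply: partial_character0 Gx.
Qed.

Lemma partial_characterD x y : G x -> G y -> G (x + y).
Proof.
by move=> Gx Gy; rewrite -[y]opprK; apply: Gpart.1 => //; apply: partial_characterN.
Qed.

Lemma partial_characterMn x n : G x -> G (x *+ n).
Proof.
move=> Gx; elim: n => [|n IHn]; first by apply: partial_character0 Gx.
by rewrite mulrS; apply: partial_characterD.
Qed.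

Lemma partial_characterMz x (m : int) : G x -> G (x *~ m).
Proof.
by case: m => n Gx; rewrite ?NegzE ?mulrNz; [|apply: partial_characterN];
   apply: partial_characterMn.
Qed.

(** The integers m with mb in the domain form an ideal of Z. If n > 0 generates it, divisibility of
    Q/Z gives q with nq the prescribed value at nb; if it is zero, q = 0 will do. *)
Lemma partial_character_step b :
  exists q : QZ, forall (m : int) r, G (b *~ m, r) -> r = q *~ m.
Proof.
have [[n0 n0G]|noG] := pselect (exists n, (0 < n)%N /\ exists r, G (b *+ n, r)).
  pose p n := `[< (0 < n)%N /\ exists r, G (b *+ n, r) >].
  have exp : exists n, p n by exists n0; apply/asboolP.
  case: (ex_minnP exp) => n /asboolP[n_gt0 [r Gr]] n_min.
  have [q qE] := QZ_divisible r n_gt0.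
  exists q => m s Gs.
  have Gs' : G (b *~ (m %% n)%Z, s - r *~ (m %/ n)%Z).
    have -> : (b *~ (m %% n)%Z, s - r *~ (m %/ n)%Z)
            = (b *~ m, s) - (b *+ n, r) *~ (m %/ n)%Z :> B * QZ.
      rewrite mulrz_modz.
      have -> : (b *+ n, r) *~ (m %/ n)%Z = (b *+ n *~ (m %/ n)%Z, r *~ (m %/ n)%Z).
        by rewrite [LHS]surjective_pairing -[_.1]/(fst _) -[_.2]/(snd _) !raddfMz.
      by [].
    by apply: Gpart.1 => //; apply: partial_characterMz.
  (* The remainder also carries b into the domain, so minimality of n forces it to vanish. *)
  have m0 : (m %% n)%Z = 0.
    have : (0 <= m %% n)%Z by rewrite modz_ge0 // eqz_nat -lt0n.
    have : (m %% n < n)%Z by rewrite ltz_pmod.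
    case: (m %% n)%Z Gs' => // k Gk kn _.
    case: k => [//|k] in Gk kn *.
    suff /n_min : p k.+1 by rewrite leqNgt -ltz_nat kn.
    by apply/asboolP; split=> //; exists (s - r *~ (m %/ n)%Z).
  move: Gs'; rewrite m0 mulr0z => /Gpart.2 /eqP.
  rewrite subr_eq0 => /eqP ->; rewrite -qE; apply/eqP.
  by rewrite eq_sym -subr_eq0 -mulrz_modz m0 mulr0z.
exists 0 => m r; rewrite mul0rz => Gr.
case: m Gr => [[|n]|n] Gr.
- exact: Gpart.2.
- by case: noG; exists n.+1; split=> //; exists r.
case: noG; exists n.+1; split=> //; exists (- r).
have -> : (b *+ n.+1, - r) = - (b *~ Negz n, r).
  by rewrite NegzE mulrNz -[RHS]/(_, _) /= opprK.
exact: partial_characterN.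
Qed.

End PartialCharacter.

(** Zorn's lemma gives a maximal extension, which [partial_character_step] would enlarge at any
    element outside its domain. *)
Lemma extend_character G0 (x0 : B * QZ) : partial_character G0 -> G0 x0 ->
  exists psi : {additive B -> QZ}, forall b q, G0 (b, q) -> psi b = q.
Proof.
move=> G0part G0x0.
(* Containing [G0] is asked of nonempty graphs only, because the empty chain has empty union. *)
have [|A [[Apart A0] Amax]] := @Zorn_bigcup (B * QZ)%type
    (fun G => partial_character G /\ (forall x, G x -> (G0 `<=` G)%classic)).
  move=> F FP Ftot; split; [split|].
  - move=> x y [X FX Xx] [Y FY Yy].
    have [XY|YX] := Ftot _ _ FX FY.
      by exists Y => //; apply: (FP _ FY).1.1 => //; apply: XY.
    by exists X => //; apply: (FP _ FX).1.1 => //; apply: YX.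
  - by move=> q [X FX /((FP _ FX).1.2)].
  - by move=> x [X FX Xx] y G0y; exists X => //; apply: (FP _ FX).2 Xx _ G0y.
have G0A : (G0 `<=` A)%classic.
  have [[x Ax]|noA] := pselect (exists x, A x); first exact: A0 Ax.
  exfalso; apply: (Amax G0); last by split=> // x _.
  split=> [|G0A]; first by move=> x Ax; case: noA; exists x.
  by apply: noA; exists x0; apply: G0A.
have Atot : forall b, exists q, A (b, q).
  move=> b; apply: contrapT => nob.
  have [q qP] := partial_character_step Apart b.
  pose A' : set (B * QZ) := fun x => exists c (m : int), A c /\ x = c + (b, q) *~ m.
  have Aq : (A `<=` A')%classic.
    by move=> c Ac; exists c, 0; rewrite mulr0z addr0.
  apply: (Amax A').
    split=> // A'A; apply: nob; exists q; apply: A'A; exists 0, 1; split.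
      exact: (partial_character0 Apart (G0A _ G0x0)).
    by rewrite add0r mulr1z.
  split; last by move=> x _; apply: subset_trans Aq.
  split=> [x y [c [m [Ac ->]]] [c' [m' [Ac' ->]]]|p [[c r] [m [Ac cE]]]].
    exists (c - c'), (m - m'); split; first exact: Apart.1.
    by rewrite mulrzBr opprD addrACA.
  have mE : (b, q) *~ m = (b *~ m, q *~ m).
    by rewrite [LHS]surjective_pairing -[_.1]/(fst _) -[_.2]/(snd _) !raddfMz.
  move: cE; rewrite mE => -[/esym/eqP]; rewrite addr_eq0 => /eqP c0 ->.
  have := partial_characterN Apart Ac; rewrite c0 -[- _]/(_, _) /= opprK.
  by move=> /qP <-; rewrite subrr.
have Auniq : forall b q q', A (b, q) -> A (b, q') -> q = q'.
  move=> b q q' Aq Aq'; apply/eqP; rewrite -subr_eq0; apply/eqP/Apart.2.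
  have -> : (0, q - q') = (b, q) - (b, q') by rewrite -[RHS]/(_, _) /= subrr.
  exact: Apart.1.
have [psi psiP] := choice Atot.
have psiB : zmod_morphism psi.
  by move=> x y; apply: (Auniq (x - y)) => //; apply: (Apart.1 (x, _) (y, _)).
by exists (to_additive psiB) => b q /G0A Abq; apply: (Auniq b).
Qed.

(** The pairs [(h a, phi a)] form a partial character because [phi] vanishes on the kernel of [h];
    this is the injectivity of Q/Z, applied to the image of [h]. *)
Lemma extend_character_along (A : zmodType) (h : {additive A -> B})
    (phi : {additive A -> QZ}) : (forall a, h a = 0 -> phi a = 0) ->
  exists psi : {additive B -> QZ}, forall a, psi (h a) = phi a.
Proof.
move=> h0.
have [] := @extend_character (fun x => exists a, x = (h a, phi a)) (h 0, phi 0).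
- split=> [_ _ [a ->] [a' ->]|q [a [/esym/h0 <- ->//]]].
  by exists (a - a'); rewrite !raddfB.
- by exists 0.
by move=> psi psiP; exists psi => a; apply: psiP; exists a.
Qed.

Lemma separating_character (I : B -> Prop) b : I 0 ->
  (forall x y, I x -> I y -> I (x - y)) -> ~ I b ->
  exists psi : {additive B -> QZ}, (forall x, I x -> psi x = 0) /\ psi b <> 0.
Proof.
move=> I0 IB nIb.
pose J : set (B * QZ) := fun x => I x.1 /\ x.2 = 0.
have Jpart : partial_character J.
  split=> [[x p] [y q] /= [Ix /= ->] [Iy /= ->]|q []//].
  by split=> /=; [apply: IB | rewrite subrr].
(* If b has finite order d modulo [I], its value must be killed by d; if the order is infinite, any
   nonzero value is allowed. *)
have [q [q_neq0 qP]] : exists q : QZ, q <> 0 /\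
    forall m : int, I (b *~ m) -> q *~ m = 0.
  have [[n n0I]|noI] := pselect (exists n, (0 < n)%N /\ I (b *+ n)).
    pose p n := `[< (0 < n)%N /\ I (b *+ n) >].
    have exp : exists n, p n by exists n; apply/asboolP.
    case: (ex_minnP exp) => d /asboolP[d_gt0 Id] d_min.
    have d1 : (1 < d)%N.
      by case: d d_gt0 Id {d_min} => [|[]].
    have [q q0 qd] := QZ_order d1; exists q; split=> // m Im.
    have Imul k : I (b *+ d *~ k).
      by have [] := @partial_characterMz _ Jpart (b *+ d, 0) k;
        rewrite // -[_.1]/(fst _) raddfMz.
    have Imod : I (b *~ (m %% d)%Z).
      have -> : b *~ (m %% d)%Z = b *~ m - b *+ d *~ (m %/ d)%Z.
        exact: mulrz_modz.
      exact: IB.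
    have m0 : (m %% d)%Z = 0.
      have : (0 <= m %% d)%Z by rewrite modz_ge0 // eqz_nat -lt0n.
      have : (m %% d < d)%Z by rewrite ltz_pmod.
      case: (m %% d)%Z Imod => // k Ik kd _.
      case: k => [//|k] in Ik kd *.
      suff /d_min : p k.+1 by rewrite leqNgt -ltz_nat kd.
      by apply/asboolP.
    have := mulrz_modz q m d.
    by rewrite m0 mulr0z qd mul0rz subr0.
  have [q q0 _] := @QZ_order 2 isT; exists q; split=> // -[[|n]|n] Im.
  - by rewrite mulr0z.
  - by case: noI; exists n.+1.
  case: noI; exists n.+1; split=> //.
  have := IB _ _ I0 Im; by rewrite sub0r NegzE mulrNz opprK.
(* The graph on I + Zb with value 0 on I and q at b; [qP] makes it single-valued. *)
have [] := @extend_character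
    (fun x => exists c (m : int), I c /\ x = (c + b *~ m, q *~ m)) 0.
- split=> [_ _ [c [m [Ic ->]]] [c' [m' [Ic' ->]]]|p [c [m [Ic [/esym/eqP]]]]].
    exists (c - c'), (m - m'); split; first exact: IB.
    by rewrite !mulrzBr -[LHS]/(_, _) /=; congr (_, _); rewrite opprD addrACA.
  rewrite addr_eq0 => /eqP cE ->; apply: qP.
  by have := IB _ _ I0 Ic; rewrite sub0r cE opprK.
- by exists 0, 0; rewrite !mulr0z addr0.
move=> psi psiP; exists psi; split=> [x Ix|].
  by apply: psiP; exists x, 0; rewrite !mulr0z addr0.
rewrite (psiP b q) //; exists 0, 1; by rewrite add0r !mulr1z.
Qed.

End ExtendCharacter.

(** * Quotients, liftings and Ext^1 *)

Definition submodule (R : pzRingType) (M : lmodType R) (N : M -> Prop) :=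
  N 0 /\ forall a x y, N x -> N y -> N (a *: x + y).

Section QuotientModule.
Variables (R : pzRingType) (M : lmodType R) (N : M -> Prop).

(* [NS] is an argument so that closedness can be inferred from the predicate. *)
Definition in_submod (NS : submodule N) : {pred M} := [pred x | `[< N x >]].

Variable NS : submodule N.

Lemma in_submod_closed : submod_closed (in_submod NS).
Proof.
split=> [|a x y /asboolP Nx /asboolP Ny]; apply/asboolP; first exact: NS.1.
exact: NS.2.
Qed.

HB.instance Definition _ :=
  GRing.isSubmodClosed.Build R M (in_submod NS) in_submod_closed.

Definition lquot : Type := Quotient.quot (in_submod NS).
HB.instance Definition _ := GRing.Zmodule.on lquot.

Definition lquot_scale (a : R) (x : lquot) : lquot :=
  (\pi_(Quotient.quot (in_submod NS)) (a *: repr x))%qT.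

Lemma lquot_scale_pi a x :
  lquot_scale a (\pi_(Quotient.quot (in_submod NS)) x)%qT =
  (\pi_(Quotient.quot (in_submod NS)) (a *: x))%qT.
Proof.
apply/eqP; rewrite /lquot_scale -Quotient.idealrBE -scalerBr rpredZ //.
by rewrite Quotient.idealrBE reprK.
Qed.

Lemma lquot_scaleA a b x :
  lquot_scale a (lquot_scale b x) = lquot_scale (a * b) x.
Proof. by elim/quotW: x => x; rewrite (lquot_scale_pi b x) !lquot_scale_pi scalerA. Qed.

Lemma lquot_scale1 : left_id 1 lquot_scale.
Proof. by elim/quotW=> x; rewrite lquot_scale_pi scale1r. Qed.

Lemma lquot_scaleDr : right_distributive lquot_scale +%R.
Proof.
move=> a; elim/quotW=> x; elim/quotW=> y.
by rewrite -raddfD !lquot_scale_pi scalerDr raddfD.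
Qed.

Lemma lquot_scaleDl x : {morph lquot_scale^~ x : a b / a + b}.
Proof.
by move=> a b; elim/quotW: x => x; rewrite !lquot_scale_pi scalerDl raddfD.
Qed.

HB.instance Definition _ := GRing.Zmodule_isLmodule.Build R lquot
  lquot_scaleA lquot_scale1 lquot_scaleDr lquot_scaleDl.

Lemma lquot_pi_linear : linear (\pi_(Quotient.quot (in_submod NS)) : M -> lquot)%qT.
Proof. by move=> a x y; rewrite raddfD /= -lquot_scale_pi. Qed.

End QuotientModule.

Lemma quotient_exists (R : pzRingType) (M : lmodType R) (N : M -> Prop) :
  submodule N ->
  exists (Q : lmodType R) (q : {linear M -> Q}),
    surj q /\ forall x, q x = 0 <-> N x.
Proof.
move=> NS; exists (lquot NS), (to_linear (lquot_pi_linear NS)); split=> [x|x].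
  by exists (repr x); rewrite /= reprK.
have -> : to_linear (lquot_pi_linear NS) x = 0 <-> x \in in_submod NS.
  rewrite /= -(raddf0 (\pi_(Quotient.quot (in_submod NS)))%qT) -[x in x \in _]subr0.
  by rewrite Quotient.idealrBE; split=> /eqP.
by split=> /asboolP.
Qed.

(** The common diagram chase behind lifting through a kernel, descending to a quotient and comparing
    presentations: [g c] is [f a] for any [a] with [d a = h c], well defined since ker d lies in ker
    f. *)
Lemma lin_factor (R : pzRingType) (A B C X : lmodType R) (d : {linear A -> B})
    (f : {linear A -> X}) (h : {linear C -> B}) :
  (forall a, d a = 0 -> f a = 0) -> (forall c, exists a, h c = d a) ->
  exists g : {linear C -> X}, forall c a, h c = d a -> g c = f a.
Proof.
move=> df /choice[s sP].
have fE a a' : d a = d a' -> f a = f a'.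
  move=> daa'; apply/eqP; rewrite -subr_eq0 -linearB; apply/eqP/df.
  by rewrite linearB daa' subrr.
have gL : linear (fun c => f (s c)).
  move=> a x y; rewrite -linearP; apply: fE.
  by rewrite linearP -!sP linearP.
by exists (to_linear gL) => c a hc; apply: fE; rewrite -sP.
Qed.

Section Submodules.
Variable R : pzRingType.
Implicit Types A B C F I M P Q T X : lmodType R.

Lemma lift_ker A B C (f : {linear A -> B}) (g : {linear B -> C})
    P (h : {linear P -> B}) :
  injective f -> exact_at f g -> (forall x, g (h x) = 0) ->
  exists h' : {linear P -> A}, forall x, f (h' x) = h x.
Proof.
move=> finj fg gh.
have [||h' h'P] := @lin_factor R A B P A f idfun h.
- by move=> a; rewrite -(linear0 f) => /finj.
- by move=> c; have /fg[x <-] := gh c; exists x.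
exists h' => x; have /fg[y yE] := gh x.
by rewrite (h'P x y (esym yE)) /= yE.
Qed.

Lemma surj_lin_factor A B X (q : {linear A -> B}) (f : {linear A -> X}) :
  surj q -> (forall a, q a = 0 -> f a = 0) ->
  exists g : {linear B -> X}, forall a, g (q a) = f a.
Proof.
move=> qs qf; have [//||g gP] := @lin_factor R A B B X q f idfun.
  by move=> c; have [a <-] := qs c; exists a.
by exists g => a; apply: gP.
Qed.

Lemma exact_comp0 A B C (f : {linear A -> B}) (g : {linear B -> C}) x :
  exact_at f g -> g (f x) = 0.
Proof. by move=> fg; apply/fg; exists x. Qed.

Lemma image_submodule A B (f : {linear A -> B}) (N : A -> Prop) :
  submodule N -> submodule (fun y => exists2 x, N x & f x = y).
Proof.
move=> [N0 NS]; split=> [|a _ _ [x Nx <-] [y Ny <-]].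
  by exists 0; rewrite ?linear0.
by exists (a *: x + y); rewrite ?linearP //; apply: NS.
Qed.

Lemma preimage_submodule A B (f : {linear A -> B}) (N : B -> Prop) :
  submodule N -> submodule (fun x => N (f x)).
Proof.
move=> [N0 NS]; split=> [|a x y Nx Ny]; first by rewrite linear0.
by rewrite linearP; apply: NS.
Qed.

Lemma full_submodule A : submodule (fun _ : A => True).
Proof. by []. Qed.

Lemma zero_submodule A : submodule (fun x : A => x = 0).
Proof. by split=> // a x y -> ->; rewrite scaler0 addr0. Qed.

Lemma coker_exists A B (f : {linear A -> B}) :
  exists (Q : lmodType R) (q : {linear B -> Q}), surj q /\ exact_at f q.
Proof.
have [Q [q [qs qP]]] := quotient_exists (image_submodule f (full_submodule A)).
exists Q, q; split=> // y; split=> [/qP[x _ <-]|[x <-]]; first by exists x.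
by apply/qP; exists x.
Qed.

Lemma image_exists A B (f : {linear A -> B}) :
  exists (K : lmodType R) (p : {linear A -> K}) (i : {linear K -> B}),
    [/\ surj p, injective i & forall x, i (p x) = f x].
Proof.
have [K [p [ps pP]]] :=
  quotient_exists (preimage_submodule f (zero_submodule B)).
have [a /pP//|i iP] := @surj_lin_factor _ _ _ p f ps.
exists K, p, i; split=> // x y.
have [a <-] := ps x; have [b <-] := ps y; rewrite !iP => fab.
apply/eqP; rewrite -subr_eq0 -linearB; apply/eqP/pP.
by rewrite linearB fab subrr.
Qed.

(** By the kernel condition [f] descends to the image of [d], which embeds in [B]. *)
Lemma injective_extend Q A B (d : {linear A -> B}) (f : {linear A -> Q}) :
  injective_module Q -> (forall a, d a = 0 -> f a = 0) ->
  exists g : {linear B -> Q}, forall a, g (d a) = f a.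
Proof.
move=> Qinj df; have [K [p [i [ps iinj iP]]]] := image_exists d.
have [|f' f'P] := @surj_lin_factor _ _ _ p f ps.
  by move=> a pa; apply: df; rewrite -iP pa linear0.
have [g gP] := Qinj _ _ i f' iinj.
by exists g => a; rewrite -iP gP f'P.
Qed.

Lemma ker_of_exact A B (f : {linear A -> B}) :
  exact_at (val : {linear ker_of f -> A}) f.
Proof.
move=> y; split=> [fy0|[x <-]]; last exact/eqP/(valP x).
have fy : y \in lin_ker f by apply/eqP.
by exists (KerOf fy).
Qed.

(* Ext^1(F, X) = 0, computed on the start P1 -> P0 of a presentation of F. *)
Definition extends_along P1 P0 (d : {linear P1 -> P0}) X :=
  forall f : {linear P1 -> X}, (forall x, d x = 0 -> f x = 0) ->
  exists g : {linear P0 -> X}, forall x, f x = g (d x).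

(** Comparison maps [u] and [u'] between [P0] and [P0'] over [F] turn a map on [P1'] into one on
    [P1]; the extension of the latter is carried back along [u'] and corrected by [v]. *)
Lemma extends_along_indep F X (P1 P0 P1' P0' : lmodType R) (d : {linear P1 -> P0})
    (q : {linear P0 -> F}) (d' : {linear P1' -> P0'})
    (q' : {linear P0' -> F}) :
  projective P0 -> surj q -> exact_at d q ->
  projective P0' -> surj q' -> exact_at d' q' ->
  extends_along d X -> extends_along d' X.
Proof.
move=> P0p qs dq P0'p q's d'q' ext f' f'd'.
have [u uP] := P0p _ _ q' q q's; have [u' u'P] := P0'p _ _ q q' qs.
have [//|c|f fP] := @lin_factor R _ _ P1 _ d' f' (u \o d).
  have /d'q'[a aE] : q' (u (d c)) = 0 by rewrite uP exact_comp0.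
  by exists a; rewrite /= aE.
have [|g gP] := ext f.
  by move=> x dx; rewrite (fP x 0) ?linear0 //= dx linear0.
(* The homotopy between [u \o u'] and the identity: c - u(u' c) lies in the image of [d'], and [v]
   evaluates [f'] on a preimage. *)
have [//|c|v vP] := @lin_factor R _ _ P0' _ d' f' (idfun \- (u \o u')).
  have /d'q'[a aE] : q' (c - u (u' c)) = 0 by rewrite linearB uP u'P subrr.
  by exists a; rewrite /= aE.
exists (GRing.add_fun (g \o u') v) => y /=.
have /dq[x xE] : q (u' (d' y)) = 0 by rewrite u'P exact_comp0.
have /d'q'[y' y'E] : q' (u (d x)) = 0 by rewrite uP exact_comp0.
rewrite -xE -gP (fP x y' (esym y'E)) (vP (d' y) (y - y')).
  by rewrite linearB addrC subrK.
by rewrite /= linearB y'E xE.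
Qed.

(** In a resolution the kernel of the first differential is the image of the second, so 1-cocycles
    are the maps vanishing on that kernel. As [P1] is arbitrary, [d] may be the inclusion of the
    kernel of [q]. *)
Lemma Ext1P F X P1 P0 (d : {linear P1 -> P0}) (q : {linear P0 -> F}) :
  projective P0 -> surj q -> exact_at d q ->
  Ext_eq0 1 F X <-> extends_along d X.
Proof.
move=> P0p qs dq; split=> [ext|ext P f fd].
  have [P] := proj_resolution_exists F.
  suff : extends_along (res_d P 0) X.
    exact (@extends_along_indep F X _ _ _ _ (res_d P 0) (@res_aug _ _ P) d q
     (@res_projective _ _ P 0) (@res_aug_surj _ _ P)
      (@res_exact0 _ _ P) P0p qs dq).
  move=> f fd.
  by apply: ext => x; apply: fd; apply: exact_comp0 (@res_exact _ _ P 0).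
have := extends_along_indep P0p qs dq (@res_projective _ _ P 0)
  (@res_aug_surj _ _ P) (@res_exact0 _ _ P) ext.
by apply=> x /(@res_exact _ _ P 0)[y <-].
Qed.

(** This is the exact sequence Hom(A, I) -> Hom(A, Q) -> Ext^1(A, X) -> Ext^1(A, I) = 0. *)
Lemma Ext1_coresP A X I Q (i : {linear X -> I}) (p : {linear I -> Q}) :
  injective_module I -> short_exact i p ->
  Ext_eq0 1 A X <->
  (forall h : {linear A -> Q}, exists h' : {linear A -> I}, forall x, p (h' x) = h x).
Proof.
move=> Iinj [iinj ip ps].
pose d : {linear ker_of (free_cover A) -> dsum A R^o} := val.
have dq : exact_at d (free_cover A) := ker_of_exact (free_cover A).
have dx0 x : free_cover A (d x) = 0 := exact_comp0 x dq.
have qs := @free_cover_surj R A.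
have Fp := @dsum_projective R A.
rewrite (Ext1P X Fp qs dq); split=> [ext h|lift f _].
  have [g gP] := Fp _ _ p (h \o free_cover A) ps.
  have [x|f fP] := @lift_ker _ _ _ i p _ (g \o d) iinj ip.
    by rewrite /= gP /= dx0 linear0.
  have [|f' f'P] := ext f.
    by move=> x /= xE; apply: iinj; rewrite fP linear0 /= xE linear0.
  have [|h' h'P] := @surj_lin_factor _ _ _ (free_cover A) (g \- (i \o f')) qs.
    by move=> a /dq[x <-] /=; rewrite -f'P fP /= subrr.
  exists h' => x; have [a <-] := qs x.
  by rewrite h'P /= linearB gP (exact_comp0 _ ip) subr0.
have [|g gP] := @injective_extend I _ _ d (i \o f) Iinj.
  by move=> a; rewrite -(linear0 d) => /val_inj -> /=; rewrite !linear0.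
have [|h hP] := @surj_lin_factor _ _ _ (free_cover A) (p \o g) qs.
  by move=> a /dq[x <-] /=; rewrite gP /= exact_comp0.
have [h' h'P] := lift h.
have [|g' g'P] := @lift_ker _ _ _ i p _ (g \- (h' \o free_cover A)) iinj ip.
  by move=> x; rewrite /= linearB h'P hP subrr.
exists g' => x; apply: iinj; rewrite g'P /= gP /=.
by rewrite dx0 linear0 subr0.
Qed.

End Submodules.

(** * Character modules *)

Section Character.
Variable M : zmodType.

Definition is_char : {pred M -> QZ} := [pred f | `[< zmod_morphism f >]].

Lemma is_char_zmod_closed : zmod_closed is_char.
Proof.
split=> [|f g /asboolP fB /asboolP gB]; apply/asboolP => x y.
  exact/esym/subr0.
by rewrite !fctE fB gB !opprD addrACA.
Qed.

HB.instance Definition _ :=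
  GRing.isZmodClosed.Build (M -> QZ) is_char is_char_zmod_closed.

Record char := Char { char_val :> M -> QZ; _ : char_val \in is_char }.

HB.instance Definition _ := [isSub for char_val].
HB.instance Definition _ := [Choice of char by <:].
HB.instance Definition _ := [SubChoice_isSubZmodule of char by <:].

Lemma char_zmod_morphism (chi : char) : zmod_morphism chi.
Proof. by case: chi => f /= /asboolP. Qed.

HB.instance Definition _ (chi : char) :=
  GRing.isZmodMorphism.Build M QZ chi (char_zmod_morphism chi).

Lemma is_charP (f : {additive M -> QZ}) : (f : M -> QZ) \in is_char.
Proof. by apply/asboolP => x y; rewrite raddfB. Qed.

Definition to_char (f : {additive M -> QZ}) : char := Char (is_charP f).

Lemma charP (chi psi : char) : (forall m, chi m = psi m) -> chi = psi.
Proof. by move=> eq; apply/val_inj/funext. Qed.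

Lemma charD (chi psi : char) m : (chi + psi) m = chi m + psi m.
Proof. by []. Qed.

Lemma char_separates (x : M) : (forall chi : char, chi x = 0) -> x = 0.
Proof.
move=> chix; apply: contrapT => x0.
have [|y z -> ->||f [_]] := @separating_character M (fun y => y = 0) x => //.
  by rewrite subr0.
by apply; apply: (chix (to_char f)).
Qed.

End Character.

Lemma char_extend (A B : zmodType) (h : A -> B) (chi : char A) :
  zmod_morphism h -> (forall a, h a = 0 -> chi a = 0) ->
  exists chi' : char B, forall a, chi' (h a) = chi a.
Proof.
move=> hB h0.
have [//|f fP] := extend_character_along (h := to_additive hB) (phi := chi).
by exists (to_char f).
Qed.

Lemma char_separates_sub (B : zmodType) (I : B -> Prop) b : I 0 ->
  (forall x y, I x -> I y -> I (x - y)) -> ~ I b ->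
  exists chi : char B, (forall x, I x -> chi x = 0) /\ chi b <> 0.
Proof.
move=> I0 IB nIb; have [f fP] := separating_character I0 IB nIb.
by exists (to_char f).
Qed.

(* Unital ring anti-homomorphisms; only the identity R -> R^c and its inverse
   are used, but the carriers of R and (R^c)^c are not convertible as rings. *)
Record antihom (R S : pzRingType) := Antihom {
  anti_val :> R -> S;
  antiD : {morph anti_val : x y / x + y};
  anti1 : anti_val 1 = 1;
  antiM : forall x y, anti_val (x * y) = anti_val y * anti_val x }.

Lemma antiB (R S : pzRingType) (phi : antihom R S) :
  {morph phi : x y / x - y}.
Proof.
by move=> x y; apply: (addIr (phi y)); rewrite -antiD !subrK.
Qed.

Section CharacterModule.
Variables (R S : pzRingType) (phi : antihom R S) (M : lmodType S).

(** The vacuous [let] records [phi] in the type, so that the module structure twisted by [phi] can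
    be inferred from it. *)
Definition char_mod : Type := let _ := phi in char M.
HB.instance Definition _ := GRing.Zmodule.on char_mod.

Lemma char_scale_subproof (r : R) (chi : char M) :
  zmod_morphism (fun m => chi (phi r *: m)).
Proof. by move=> x y; rewrite scalerBr raddfB. Qed.

Definition char_scale (r : R) (chi : char_mod) : char_mod :=
  to_char (to_additive (char_scale_subproof r chi)).

Lemma char_scaleA a b chi : char_scale a (char_scale b chi) = char_scale (a * b) chi.
Proof. by apply: charP => m /=; rewrite antiM scalerA. Qed.

Lemma char_scale1 : left_id 1 char_scale.
Proof. by move=> chi; apply: charP => m /=; rewrite anti1 scale1r. Qed.

Lemma char_scaleDr : right_distributive char_scale +%R.
Proof. by move=> a chi psi; apply: charP. Qed.

Lemma char_scaleDl chi : {morph char_scale^~ chi : a b / a + b}.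
Proof.
by move=> a b; apply: charP => m /=; rewrite antiD scalerDl raddfD.
Qed.

HB.instance Definition _ := GRing.Zmodule_isLmodule.Build R char_mod
  char_scaleA char_scale1 char_scaleDr char_scaleDl.

Definition cval (chi : char_mod) : char M := chi.

Lemma cval_sum (I : finType) (chi : I -> char_mod) m :
  cval (\sum_i chi i) m = \sum_i cval (chi i) m.
Proof. by apply: (big_morph (fun psi => cval psi m)). Qed.

End CharacterModule.

Arguments cval : simpl never.

Lemma char_linear (R S : pzRingType) (phi : antihom R S) (A : lmodType R)
    (M : lmodType S) (f : A -> M -> QZ) :
  (forall a x y, f a (x - y) = f a x - f a y) ->
  (forall r a b x, f (r *: a + b) x = f a (phi r *: x) + f b x) ->
  exists g : {linear A -> char_mod phi M}, forall a x, cval (g a) x = f a x.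
Proof.
move=> fB fL.
pose g a : char_mod phi M := to_char (to_additive (fB a : zmod_morphism (f a))).
have gL : linear g by move=> r a b; apply: charP => x; apply: fL.
by exists (to_linear gL).
Qed.

Section CharacterDuality.
Variables (R S : pzRingType) (phi : antihom R S) (psi : antihom S R).
Hypothesis psiK : cancel psi phi.

(** Both maps encode the same balanced pairing A x M -> Q/Z, read from either side. *)
Lemma char_flip (A : lmodType R) (M : lmodType S)
    (f : {linear A -> char_mod phi M}) :
  exists g : {linear M -> char_mod psi A},
    forall m a, cval (g m) a = cval (f a) m.
Proof.
apply: char_linear => [m x y|s m m' a]; first by rewrite linearB.
by rewrite raddfD linearZ /= psiK.
Qed.

End CharacterDuality.

Section CharacterDual.
Variables (R S : pzRingType) (phi : antihom R S).

Lemma char_dual (M N : lmodType S) (f : {linear M -> N}) :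
  exists g : {linear char_mod phi N -> char_mod phi M},
    forall chi m, cval (g chi) m = cval chi (f m).
Proof.
apply: char_linear => [chi x y|r chi chi' m]; first by rewrite linearB raddfB.
by rewrite linearZ.
Qed.

(** A character of B that is trivial on im f = ker g extends along [g] by injectivity of Q/Z. *)
Lemma char_dual_exact (A B C : lmodType S) (f : {linear A -> B})
    (g : {linear B -> C}) (f' : {linear char_mod phi B -> char_mod phi A})
    (g' : {linear char_mod phi C -> char_mod phi B}) :
  (forall chi a, cval (f' chi) a = cval chi (f a)) ->
  (forall chi b, cval (g' chi) b = cval chi (g b)) ->
  exact_at f g -> exact_at g' f'.
Proof.
move=> f'P g'P fg chi; split=> [f'chi|[chi' <-]]; last first.
  by apply: charP => a; rewrite f'P g'P (exact_comp0 _ fg) raddf0.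
have [b gb|psi psiP] := char_extend (chi := cval chi) (linearB g).
  by have /fg[a <-] := gb; rewrite -f'P f'chi.
by exists (psi : char_mod phi C); apply: charP => b; rewrite -[LHS]/(cval _ b) g'P.
Qed.

Lemma char_dual_short_exact (A B C : lmodType S) (f : {linear A -> B})
    (g : {linear B -> C}) :
  short_exact f g ->
  exists (g' : {linear char_mod phi C -> char_mod phi B})
         (f' : {linear char_mod phi B -> char_mod phi A}),
    [/\ short_exact g' f', forall chi a, cval (f' chi) a = cval chi (f a) &
        forall chi b, cval (g' chi) b = cval chi (g b)].
Proof.
move=> [finj fg gs]; have [f' f'P] := char_dual f; have [g' g'P] := char_dual g.
exists g', f'; split=> //; split.
- move=> chi chi' eq; apply: charP => c; have [b <-] := gs c.
  by rewrite -!g'P eq.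
- exact: char_dual_exact f'P g'P fg.
move=> chi.
have [a fa|psi psiP] := char_extend (chi := cval chi) (linearB f).
  by have -> : a = 0 by [apply: finj; rewrite fa linear0]; rewrite raddf0.
by exists (psi : char_mod phi B); apply: charP => a; rewrite -[LHS]/(cval _ a) f'P.
Qed.

End CharacterDual.

Section CharacterInjective.
Variables (R S : pzRingType) (phi : antihom R S) (psi : antihom S R).
Hypotheses (phiK : cancel phi psi) (psiK : cancel psi phi).

(* A map A -> P^+ is the same as a map P -> A^+, which lifts along B^+ -> A^+. *)
Lemma char_projective_injective (P : lmodType S) :
  projective P -> injective_module (char_mod phi P).
Proof.
move=> Pp A B i f iinj.
have [f' f'P] := char_flip psiK f.
have [i' i'P] := char_dual psi i.
have i's : surj i'.
  move=> chi.
  have [a ia|chi' chi'P] := char_extend (chi := cval chi) (linearB i).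
    by have -> : a = 0 by [apply: iinj; rewrite ia linear0]; rewrite raddf0.
  exists (chi' : char_mod psi B); apply: charP => a.
  by rewrite -[LHS]/(cval _ a) i'P.
have [g' g'P] := Pp _ _ i' f' i's.
have [g gP] := char_flip phiK g'.
by exists g => a; apply: charP => p; rewrite -[LHS]/(cval _ p) gP -i'P g'P f'P.
Qed.

Lemma free_mod_projective (T : pzRingType) (k : nat) : projective ('rV[T]_k).
Proof.
move=> A B q f qs; have [s sP] := choice (fun j => qs (f (delta_mx 0 j))).
have gL : linear (fun u : 'rV[T]_k => \sum_j u 0 j *: s j).
  move=> a u v; rewrite scaler_sumr -big_split; apply: eq_bigr => j _.
  by rewrite !mxE scalerDl scalerA.
exists (to_linear gL) => u /=.
rewrite [in RHS](row_sum_delta u) !linear_sum; apply: eq_bigr => j _.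
by rewrite !linearZ /= sP.
Qed.

Lemma regular_projective (T : pzRingType) : projective T^o.
Proof.
move=> A B q f qs; have [a aP] := qs (f 1).
have gL : linear (fun r : T^o => (r : T) *: a).
  by move=> r x y; rewrite scalerDl scalerA.
exists (to_linear gL) => r /=; rewrite linearZ /= aP -linearZ /=.
by congr (f _); rewrite /GRing.scale /= mulr1.
Qed.

Lemma char_regular_injective : injective_module (char_mod phi S^o).
Proof. by apply: char_projective_injective; apply: regular_projective. Qed.

(** A character chi of B corresponds to the map b |-> (s |-> chi(s b)), whose value at s = 1 is chi
    itself; characters separate points. *)
Lemma char_regular_cogenerator : cogenerator (char_mod phi S^o).
Proof.
move=> A B f [x fx0].
have [chi chix] : exists chi : char B, chi (f x) <> 0.
  apply: contrapT => nochi; apply: fx0; apply: char_separates => chi.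
  by apply: contrapT => chifx; apply: nochi; exists chi.
have fB b (y z : S^o) : chi (psi (y - z) *: b) = chi (psi y *: b) - chi (psi z *: b).
  by rewrite antiB scalerBl raddfB.
have fL r b b' (s : S^o) : chi (psi s *: (r *: b + b')) =
    chi (psi (phi r *: s) *: b) + chi (psi s *: b').
  by rewrite scalerDr scalerA raddfD antiM phiK.
have [h hP] := char_linear fB fL.
exists h, x => hfx; apply: chix; have := hP (f x) (1 : S).
by rewrite hfx anti1 scale1r.
Qed.

(* Y embeds in Y^++, hence in the dual of a free module covering Y^+. *)
Lemma enough_injectives (Y : lmodType R) :
  exists (I : lmodType R) (i : {linear Y -> I}), injective_module I /\ injective i.
Proof.
pose L := dsum (char_mod psi Y) S^o.
have qs := @free_cover_surj S (char_mod psi Y).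
have [i iP] := char_flip phiK (free_cover (char_mod psi Y)).
exists (char_mod phi L), i; split.
  apply: char_projective_injective; exact: dsum_projective.
move=> x y ixy; apply/eqP; rewrite -subr_eq0; apply/eqP/char_separates => chi.
have [l lE] := qs (chi : char_mod psi Y).
have -> : chi (x - y) = cval (chi : char_mod psi Y) (x - y) by [].
by rewrite -lE -iP linearB ixy subrr.
Qed.

End CharacterInjective.

(** * Tensor products and Tor_1 *)

Definition to_opp (R : pzRingType) : antihom R R^c :=
  @Antihom R R^c (fun r => r) (fun _ _ => erefl) erefl (fun _ _ => erefl).

Definition of_opp (R : pzRingType) : antihom R^c R :=
  @Antihom R^c R (fun r => r) (fun _ _ => erefl) erefl (fun _ _ => erefl).

Lemma to_oppK (R : pzRingType) : cancel (to_opp R) (of_opp R).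
Proof. by []. Qed.

Lemma of_oppK (R : pzRingType) : cancel (of_opp R) (to_opp R).
Proof. by []. Qed.

Section TensorCharacter.
Variables (R : pzRingType) (M : lmodType R^c).
Implicit Types F G P : lmodType R.

(** A representative in the free abelian group is a sum of integer multiples of pairs, and closure
    under subtraction yields those multiples. *)
Lemma tensor_ind F (D : tensor M F -> Prop) :
  (forall m x, D (tens m x)) -> D 0 -> (forall s t, D s -> D t -> D (s - t)) ->
  forall t, D t.
Proof.
move=> Dtens D0 DB; elim/quotW => a.
have DN s : D s -> D (- s) by move=> Ds; rewrite -sub0r; apply: DB.
have DD s t : D s -> D t -> D (s + t) by move=> Ds Dt; rewrite -[t]opprK; apply/DB/DN.
have DMz s (m : int) : D s -> D (s *~ m).
  have DMn n : D s -> D (s *+ n).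
    by move=> Ds; elim: n => [//|n IHn]; rewrite mulrS; apply: DD.
  by case: m => n Ds; rewrite ?NegzE ?mulrNz -?pmulrn; [|apply: DN]; apply: DMn.
rewrite -(freeg_sumE a) raddf_sum; apply: (big_ind D) => // -[m x] _.
have -> : << coeff (m, x) a *g (m, x) >> = << (m, x) >> *~ coeff (m, x) a
    :> {freeg (M * F)%type / int}.
  by rewrite freegU_mulz intz.
by rewrite raddfMz; apply/DMz/Dtens.
Qed.

Lemma tensor_map0 F G (f : {linear F -> G}) : tensor_map (M := M) f 0 = 0.
Proof. by apply: (addrI (tensor_map f 0)); rewrite -tensor_mapD !addr0. Qed.

Lemma tensor_mapB F G (f : {linear F -> G}) : zmod_morphism (tensor_map (M := M) f).
Proof.
by move=> s t; apply: (addIr (tensor_map f t)); rewrite -tensor_mapD !subrK.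
Qed.

Lemma pi_balanced_relator F (y : {freeg (M * F)%type / int}) :
  balanced_relator y -> (\pi_(Quotient.quot (@tensor_rel R M F)) y)%qT = 0.
Proof.
move=> yrel; rewrite -(raddf0 (\pi_(Quotient.quot (@tensor_rel R M F)))%qT).
by apply/tensor_eq; rewrite subr0; apply/asboolP => S _; apply.
Qed.

Lemma tensDl F (m m' : M) (x : F) : tens (m + m') x = tens m x + tens m' x.
Proof.
have /eqP := pi_balanced_relator (Or31 _ _ (ex_intro _ m (ex_intro _ m'
  (ex_intro _ x (erefl (<< (m + m', x) >> - << (m, x) >> - << (m', x) >>)))))).
by rewrite !raddfB -addrA -opprD subr_eq0 => /eqP.
Qed.

Lemma tensDr F (m : M) (x x' : F) : tens m (x + x') = tens m x + tens m x'.
Proof.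
have /eqP := pi_balanced_relator (Or32 _ _ (ex_intro _ m (ex_intro _ x
  (ex_intro _ x' (erefl (<< (m, x + x') >> - << (m, x) >> - << (m, x') >>)))))).
by rewrite !raddfB -addrA -opprD subr_eq0 => /eqP.
Qed.

Lemma tensZ F (m : M) (r : R) (x : F) : tens ((r : R^c) *: m) x = tens m (r *: x).
Proof.
have /eqP := pi_balanced_relator (Or33 _ _ (ex_intro _ m (ex_intro _ r
  (ex_intro _ x (erefl (<< ((r : R^c) *: m, x) >> - << (m, r *: x) >>)))))).
by rewrite raddfB subr_eq0 => /eqP.
Qed.

(* Hom_Z(M (x) P, Q/Z) = Hom_R(P, M^+) *)
Lemma char_of_hom P (f : {linear P -> char_mod (to_opp R) M}) :
  exists chi : char (tensor M P), forall m x, chi (tens m x) = cval (f x) m.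
Proof.
pose g := fglift (fun z : M * P => cval (f z.2) z.1 : zmodule QZ).
have gB : zmod_morphism g by move=> x y; rewrite /g raddfB.
have g1 z : g << z >> = cval (f z.2) z.1.
  by rewrite /g liftU.
have grel a : a \in @tensor_rel R M P -> g a = 0.
  move=> /asboolP /(_ [pred z | g z == 0]) h; apply/eqP/h.
    split=> [|x y]; rewrite !inE ?gB; first by rewrite -(subrr 0) gB subrr.
    by move=> /eqP -> /eqP ->; rewrite subrr.
  move=> y [[m [m' [x ->]]]|[m [x [x' ->]]]|[m [r [x ->]]]];
    rewrite inE !gB !g1 /=.
  - by rewrite raddfD -addrA -opprD subrr.
  - by rewrite linearD charD -addrA -opprD subrr.
  - by rewrite linearZ subrr.
have gpi a : g (repr (\pi_(Quotient.quot (@tensor_rel R M P)) a)%qT) = g a.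
  apply/eqP; rewrite -subr_eq0 -gB; apply/eqP/grel/tensor_eq.
  by rewrite reprK.
have hB : zmod_morphism (fun t : tensor M P => g (repr t) : QZ).
  elim/quotW => a; elim/quotW => b; rewrite -raddfB !gpi; exact: gB.
by exists (to_char (to_additive hB)) => m x /=; rewrite gpi g1.
Qed.

Lemma hom_of_char P (chi : char (tensor M P)) :
  exists f : {linear P -> char_mod (to_opp R) M},
    forall x m, cval (f x) m = chi (tens m x).
Proof.
apply: char_linear => [x m m'|r x y m].
  apply: (addIr (chi (tens m' x))).
  by rewrite subrK -raddfD -tensDl subrK.
by rewrite tensDr raddfD /= tensZ.
Qed.

(** By [char_of_hom] and [hom_of_char], Hom(P, M^+) is the character dual of M (x) P. Since Q/Z is
    an injective cogenerator, exactness passes both ways between the complex and its dual. *)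
Lemma Tor1_char F : Tor_eq0 1 M F <-> Ext_eq0 1 F (char_mod (to_opp R) M).
Proof.
split=> [tor P f fd|ext P].
  have [chi chiP] := char_of_hom f.
  have [|psi psiP] := char_extend (chi := chi) (tensor_mapB (res_d P 0%N)).
    move=> t /(tor P)[s <-]; elim/tensor_ind: s => [m x||s t' s0 t0].
    - by rewrite tensor_map_tens chiP fd.
    - by rewrite tensor_map0 raddf0.
    - by rewrite tensor_mapB char_zmod_morphism s0 t0 subrr.
  have [g gP] := hom_of_char psi.
  exists g => x; apply: charP => m; rewrite -[RHS]/(cval _ m) gP.
  by rewrite -tensor_map_tens psiP chiP.
move=> t; split=> [dt0|[s <-]]; last first.
  elim/tensor_ind: s => [m x||s t' s0 t0].
  - rewrite !tensor_map_tens (exact_comp0 x (@res_exact _ _ P 0)).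
    by apply: (addrI (tens m 0)); rewrite -tensDr !addr0.
  - by rewrite !tensor_map0.
  - by rewrite !tensor_mapB s0 t0 subrr.
(* A cycle that is no boundary is detected by a character trivial on boundaries; vanishing of Ext^1
   factors this character through the differential, which kills the cycle. *)
apply: contrapT => nt.
have [|_ _ [s <-] [s' <-]|chi [chi0 chit]] :=
  @char_separates_sub _ (fun t => exists s, tensor_map (res_d P 1%N) s = t) t _ _ nt.
- by exists 0; rewrite tensor_map0.
- by exists (s - s'); rewrite tensor_mapB.
have [f fP] := hom_of_char chi.
have [x|g gP] := ext P f.
  apply: charP => m; rewrite -[LHS]/(cval _ m) fP -tensor_map_tens.
  by apply: chi0; eexists.
have [psi psiP] := char_of_hom g.
apply: chit.
have -> : chi t = psi (tensor_map (res_d P 0%N) t).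
  elim/tensor_ind: t {dt0 nt} => [m x||s t s0 t0].
  - by rewrite tensor_map_tens psiP -gP fP.
  - by rewrite tensor_map0 !raddf0.
  - by rewrite tensor_mapB !char_zmod_morphism s0 t0.
by rewrite dt0 raddf0.
Qed.

End TensorCharacter.

Lemma FP_Flat_char (R : pzRingType) (n : nat) (M : lmodType R^c) :
  FP_Flat n M <-> FP_Inj n (char_mod (to_opp R) M).
Proof. by split=> h F /h /Tor1_char. Qed.

(** * Finite presentations as matrices *)

Section MatrixAction.
Variables (S : pzRingType) (N : lmodType S).

Definition mact p q (A : 'M[S]_(p, q)) (z : 'I_q -> N) : 'I_p -> N :=
  fun i => \sum_j A i j *: z j.

(** Solvability of linear systems: each right-hand side satisfying the compatibility equations B z =
    0 admits a solution of A y = z. *)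
Definition mexact p q r (A : 'M[S]_(q, p)) (B : 'M[S]_(r, q)) :=
  forall z, mact B z = 0 -> exists y, mact A y = z.

Lemma mact_zmod_morphism p q (A : 'M[S]_(p, q)) : zmod_morphism (mact A).
Proof.
move=> y z; apply/funext => i.
change (\sum_j A i j *: (y j - z j) =
  \sum_j A i j *: y j - \sum_j A i j *: z j).
by rewrite -sumrB; apply: eq_bigr => j _; rewrite -scalerBr.
Qed.

Definition single q (j : 'I_q) (x : N) : 'I_q -> N := fun i => if i == j then x else 0.

Lemma single_zmod_morphism q (j : 'I_q) : zmod_morphism (single j).
Proof.
move=> x y; apply/funext => i; rewrite /single !fctE.
by case: eqP => // _; rewrite subrr.
Qed.

Lemma single_sum q (z : 'I_q -> N) : z = \sum_j single j (z j).
Proof.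
apply/funext => i; rewrite fct_sumE (bigD1 i) //= /single eqxx big1 ?addr0 // => j.
by rewrite eq_sym => /negPf ->.
Qed.

End MatrixAction.

Lemma mexact_fun (S : pzRingType) (N : lmodType S) (J : Type) p q r
    (A : 'M[S]_(q, p)) (B : 'M[S]_(r, q)) :
  mexact N A B -> mexact (J -> N : lmodType S) A B.
Proof.
move=> ex z Bz.
have /choice[y yP] : forall j, exists y, mact A y = (fun i => z i j).
  move=> j; apply: ex; apply/funext => i.
  by transitivity (mact B z i j); [rewrite /mact fct_sumE | rewrite Bz].
exists (fun i j => y j i); apply/funext => i; apply/funext => j.
by have := congr1 (fun f => f i) (yP j) => /= <-; rewrite /mact fct_sumE.
Qed.

Section PairingDuality.
Variables (R S : pzRingType) (phi : antihom R S) (N : lmodType S).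
Local Notation dual := (char_mod phi N).

Definition pairing q (mu : 'I_q -> dual) (z : 'I_q -> N) : QZ :=
  \sum_j cval (mu j) (z j).

Lemma pairing_zmod_morphism q (mu : 'I_q -> dual) : zmod_morphism (pairing mu).
Proof.
by move=> y z; rewrite /pairing -sumrB; apply: eq_bigr => j _; rewrite -raddfB.
Qed.

Lemma char_pairing q (chi : char ('I_q -> N)) :
  exists mu : 'I_q -> dual, forall z, chi z = pairing mu z.
Proof.
have sB j : zmod_morphism (fun x => chi (single j x)).
  by move=> x y; rewrite single_zmod_morphism raddfB.
exists (fun j => to_char (to_additive (sB j)) : dual) => z.
by rewrite {1}(single_sum z) raddf_sum.
Qed.

Lemma pairing_single q (mu : 'I_q -> dual) j x :
  pairing mu (single j x) = cval (mu j) x.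
Proof.
rewrite /pairing (bigD1 j) //= {1}/single eqxx big1 ?addr0 // => i /negPf ij.
by rewrite /single ij raddf0.
Qed.

Lemma pairing_inj q (mu nu : 'I_q -> dual) :
  (forall z, pairing mu z = pairing nu z) -> mu = nu.
Proof.
move=> eq; apply/funext => j; apply: charP => x.
by have := eq (single j x); rewrite !pairing_single.
Qed.

Lemma pairing_mact p q (A : 'M[R]_(p, q)) (mu : 'I_q -> dual) (z : 'I_p -> N) :
  pairing (mact A mu) z = pairing mu (mact (map_mx phi A^T) z).
Proof.
rewrite /pairing /mact; under eq_bigr do rewrite cval_sum.
rewrite exchange_big; apply: eq_bigr => j _; rewrite raddf_sum.
by apply: eq_bigr => i _; rewrite !mxE.
Qed.

Lemma pairing0 q (z : 'I_q -> N) : pairing 0 z = 0.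
Proof. by rewrite /pairing big1. Qed.

Variables (p q r : nat) (A : 'M[R]_(p, q)) (B : 'M[R]_(q, r)).

(** The character of N^q given by [mu] kills the image of the transpose of A, hence the kernel of
    the transpose of B, so it extends along the latter. *)
Lemma mexact_dual :
  mexact N (map_mx phi A^T) (map_mx phi B^T) -> mexact dual B A.
Proof.
move=> ex mu Amu; pose chi := to_char (to_additive (pairing_zmod_morphism mu)).
have [z|chi' chi'P] :=
  char_extend (chi := chi) (mact_zmod_morphism (N := N) (map_mx phi B^T)).
  move=> /ex[y <-]; rewrite /= -pairing_mact Amu; exact: pairing0.
have [nu nuP] := char_pairing chi'.
exists nu; apply: pairing_inj => z.
by rewrite pairing_mact -nuP chi'P.
Qed.

(** A tuple outside the image would be separated from it by a character; that character comes from
    the dual of [B], so it vanishes on the tuple. *)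
Lemma mexact_of_dual :
  mexact dual B A -> mexact N (map_mx phi A^T) (map_mx phi B^T).
Proof.
move=> ex z Bz; apply: contrapT => nz.
have [|_ _ [x <-] [y <-]|chi [chi0 chiz]] := @char_separates_sub _
    (fun z => exists y : 'I_p -> N, mact (map_mx phi A^T) y = z) z _ _ nz.
- by exists 0; apply: (raddf0 (to_additive (mact_zmod_morphism _))).
- by exists (x - y); rewrite mact_zmod_morphism.
have [mu muP] := char_pairing chi.
have [|nu nuP] := ex mu.
  apply: pairing_inj => y; rewrite pairing_mact -muP pairing0.
  by apply: chi0; exists y.
apply: chiz; rewrite muP -nuP pairing_mact Bz.
by rewrite /pairing big1 // => j _; rewrite raddf0.
Qed.

End PairingDuality.

Section Presentations.
Variable R : pzRingType.

Definition row_hom (X : lmodType R) k (z : 'I_k -> X) (u : 'rV[R]_k) : X :=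
  \sum_i u 0 i *: z i.

Lemma row_hom_linear (X : lmodType R) k (z : 'I_k -> X) : linear (row_hom z).
Proof.
move=> a u v; rewrite /row_hom scaler_sumr -big_split; apply: eq_bigr => i _.
by rewrite !mxE scalerDl scalerA.
Qed.

HB.instance Definition _ (X : lmodType R) k (z : 'I_k -> X) :=
  GRing.isLinear.Build R 'rV[R]_k X *:%R (row_hom z) (row_hom_linear z).

Lemma row_hom_delta (X : lmodType R) k (z : 'I_k -> X) i :
  row_hom z (delta_mx 0 i) = z i.
Proof.
rewrite /row_hom (bigD1 i) //= mxE !eqxx scale1r big1 ?addr0 // => j /negPf ji.
by rewrite mxE ji andbF scale0r.
Qed.

Lemma row_homE (X : lmodType R) k (f : {linear 'rV[R]_k -> X}) u :
  f u = row_hom (fun i => f (delta_mx 0 i)) u.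
Proof.
rewrite {1}(row_sum_delta u) linear_sum; apply: eq_bigr => i _.
by rewrite linearZ.
Qed.

Lemma row_hom_mul (X : lmodType R) k l (z : 'I_l -> X)
    (d : {linear 'rV[R]_k -> 'rV[R]_l}) u :
  row_hom z (d u) = row_hom (mact (lin1_mx d) z) u.
Proof.
rewrite -mul_rV_lin1 /row_hom /mact.
under [RHS]eq_bigr do rewrite scaler_sumr.
rewrite exchange_big; apply: eq_bigr => j _; rewrite mxE scaler_suml.
by apply: eq_bigr => i _; rewrite scalerA.
Qed.

(** Maps from R^a are tuples z. Vanishing on ker d0 = im d1 means that the matrix of [d1]
    annihilates z, and extending along [d0] means that z lies in the image of the matrix of [d0]. *)
Lemma extends_along_mexact (X : lmodType R) a b m
    (d1 : {linear 'rV[R]_b -> 'rV[R]_a}) (d0 : {linear 'rV[R]_a -> 'rV[R]_m}) :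
  exact_at d1 d0 ->
  extends_along d0 X <-> mexact X (lin1_mx d0) (lin1_mx d1).
Proof.
move=> d10; split=> [ext z Dz|ex f fd].
  have [|g gP] := ext (row_hom z).
    move=> u /d10[v <-]; rewrite /= row_hom_mul Dz /row_hom big1 // => i _.
    exact: scaler0.
  exists (fun j => g (delta_mx 0 j)); apply/funext => i.
  rewrite -[RHS](row_hom_delta z) [RHS]gP [RHS]row_homE.
  by rewrite [RHS]row_hom_mul row_hom_delta.
have [|y yP] := ex (fun i => f (delta_mx 0 i)).
  apply/funext => l; rewrite -[LHS](row_hom_delta (mact _ _)) -row_hom_mul.
  by rewrite -row_homE fd // (exact_comp0 _ d10).
exists (row_hom y) => u; rewrite [RHS]row_hom_mul yP; exact: row_homE.
Qed.

(** A finite n-presentation without its module, which is recovered as the cokernel of [d 0]. *)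
Definition presentation (n : nat) (k : nat -> nat)
    (d : forall i, {linear 'rV[R]_(k i.+1) -> 'rV[R]_(k i)}) :=
  forall i, (i.+1 < n)%N -> exact_at (d i.+1) (d i).

Lemma FP_InjP n (X : lmodType R) : (0 < n)%N ->
  FP_Inj n X <-> (forall k d, @presentation n k d -> extends_along (d 0%N) X).
Proof.
move=> n0; split=> [inj k d dP|ext F [k [e [d [es /(_ n0) de dP]]]]].
  have [F [e [es de]]] := coker_exists (d 0%N).
  have FP : fin_presented n F by exists k, e, d.
  exact/(Ext1P X (@free_mod_projective _ _) es de)/inj.
exact/(Ext1P X (@free_mod_projective _ _) es de)/ext.
Qed.

(** The bound n > 1 provides exactness at R^(k 1), which turns the condition on the kernel of [d 0]
    into finitely many equations. *)
Lemma FP_Inj_mexact n (X : lmodType R) : (1 < n)%N ->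
  FP_Inj n X <-> (forall k d, @presentation n k d ->
    mexact X (lin1_mx (d 0%N)) (lin1_mx (d 1%N))).
Proof.
move=> n1; rewrite FP_InjP 1?ltnW //; split=> h k d dP.
  by apply/(extends_along_mexact X (dP 0%N n1)); apply: h.
by apply/(extends_along_mexact X (dP 0%N n1)); apply: h.
Qed.

End Presentations.

Section FlatMatrix.
Variables (R : pzRingType) (n : nat).
Hypothesis n1 : (1 < n)%N.

Definition opp_tr p q (A : 'M[R]_(p, q)) : 'M[R^c]_(q, p) :=
  map_mx (to_opp R) A^T.

Lemma FP_Flat_mexact (M : lmodType R^c) :
  FP_Flat n M <-> (forall k d, @presentation R n k d ->
    mexact M (opp_tr (lin1_mx (d 1%N))) (opp_tr (lin1_mx (d 0%N)))).
Proof.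
rewrite FP_Flat_char FP_Inj_mexact //; split=> h k d dP.
  by apply: mexact_of_dual; apply: h.
by apply: mexact_dual; apply: h.
Qed.

Lemma FP_Flat_fun (J : Type) (M : lmodType R^c) :
  FP_Flat n M -> FP_Flat n (J -> M : lmodType R^c).
Proof. by move=> /FP_Flat_mexact h; apply/FP_Flat_mexact => k d /h /mexact_fun. Qed.

Lemma FP_Inj_char (T : lmodType R) :
  FP_Inj n T -> FP_Flat n (char_mod (of_opp R) T).
Proof.
move=> /(FP_Inj_mexact _ n1) h; apply/FP_Flat_mexact => k d /h ex.
apply: mexact_dual.
have trK p q (A : 'M[R]_(p, q)) : map_mx (of_opp R) (opp_tr A)^T = A.
  by apply/matrixP => i j; rewrite !mxE.
by rewrite !trK.
Qed.

End FlatMatrix.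

(** * Dimension shifting and summands *)

Section Dimension.
Variable R : pzRingType.
Implicit Types A B C I K P Q T X Y : lmodType R.

Lemma injective_embedding Y :
  exists (I : lmodType R) (i : {linear Y -> I}), injective_module I /\ injective i.
Proof. exact: (enough_injectives (@to_oppK R) (@of_oppK R)). Qed.

Lemma injective_embedding_exact Y :
  exists (I Q : lmodType R) (i : {linear Y -> I}) (p : {linear I -> Q}),
    injective_module I /\ short_exact i p.
Proof.
have [I [i [Iinj iinj]]] := injective_embedding Y.
have [Q [p [ps ip]]] := coker_exists i.
by exists I, Q, i, p.
Qed.

Lemma Ext_injective I A k : injective_module I -> Ext_eq0 k.+1 A I.
Proof.
move=> Iinj P f fd; have [x|g gP] := injective_extend (d := res_d P k) (f := f) Iinj.
  by move/(@res_exact _ _ P)=> [y <-].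
by exists g.
Qed.

Lemma Ext_dimension_shift A X I Q (i : {linear X -> I}) (p : {linear I -> Q}) k :
  injective_module I -> short_exact i p -> Ext_eq0 k.+1 A Q -> Ext_eq0 k.+2 A X.
Proof.
move=> Iinj [iinj ip ps] ext P f fd.
have [x|g gP] := injective_extend (d := res_d P k.+1) (f := i \o f) Iinj.
  by move/(@res_exact _ _ P)=> [y <-]; rewrite /= fd linear0.
have [x|h hP] := ext P (p \o g); first by rewrite /= gP /= (exact_comp0 _ ip).
have [h' h'P] := @res_projective _ _ P k _ _ p h ps.
have [x|g' g'P] := @lift_ker _ _ _ _ i p _ (g \- (h' \o res_d P k)) iinj ip.
  by rewrite /= linearB h'P -hP subrr.
exists g' => x; apply: iinj; rewrite g'P /= gP.
by rewrite (exact_comp0 x (@res_exact _ _ P k)) linear0 subr0.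
Qed.

Lemma Ext_idim_le1 A C k : idim_le1 C -> Ext_eq0 k.+2 A C.
Proof.
move=> [I0 [I1 [i [p [I0inj I1inj ip]]]]].
exact: (Ext_dimension_shift I0inj ip (Ext_injective I1inj)).
Qed.

(** The cosyzygies of [X] are quotients of injectives and so stay in [D]; shift dimension down to
    degree 1. *)
Lemma Ext_higher (D : lmodType R -> Prop) A :
  (forall I X (p : {linear I -> X}), injective_module I -> surj p -> D X) ->
  (forall X, D X -> Ext_eq0 1 A X) -> forall k X, D X -> Ext_eq0 k.+1 A X.
Proof.
move=> Dq D1; elim=> [|k IHk] X DX; first exact: D1.
have [I [Q [i [p [Iinj ip]]]]] := injective_embedding_exact X.
apply: (Ext_dimension_shift Iinj ip); apply: IHk.
by case: ip => _ _ ps; apply: Dq Iinj ps.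
Qed.

(* To lift K -> Q along A -> Q, embed A in an injective I with image of ker(A -> Q)
   called L, extend K -> Q -> I/L to P and lift it to I. *)
Lemma ker_projective K P T (d : {linear K -> P}) (q : {linear P -> T}) :
  projective P -> short_exact d q ->
  (forall I X (p : {linear I -> X}), injective_module I -> surj p ->
    Ext_eq0 1 T X) ->
  projective K.
Proof.
move=> Pp [dinj dq qs] ext A Q alpha f alphas.
have [I [i [Iinj iinj]]] := injective_embedding A.
have [X [p [ps pP]]] := quotient_exists
  (image_submodule i (preimage_submodule alpha (zero_submodule Q))).
have [a a0|b bP] := surj_lin_factor (q := alpha) (f := p \o i) alphas.
  by apply/pP; exists a.
have binj y : b y = 0 -> y = 0.
  have [a <-] := alphas y; rewrite bP => /pP[a' a'0 /iinj <-].
  exact: a'0.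
have dqX : extends_along d X.
  by apply/(Ext1P X Pp qs dq)/(ext I X p).
have [x|g gP] := dqX (b \o f).
  by rewrite -(linear0 d) => /dinj ->; rewrite linear0.
have [g' g'P] := Pp _ _ p g ps.
have gi x : exists a, i a = g' (d x).
  have [a aP] := alphas (f x).
  have /pP[a' _ a'E] : p (g' (d x) - i a) = 0.
    rewrite linearB g'P -gP /= -aP bP.
    exact: subrr.
  by exists (a' + a); rewrite linearD a'E subrK.
have [|x|h hP] := @lin_factor _ _ _ _ _ i idfun (g' \o d).
- by move=> a; rewrite -(linear0 i) => /iinj.
- by have [a aP] := gi x; exists a.
exists h => x; apply/eqP; rewrite -subr_eq0; apply/eqP/binj.
have [a aP] := gi x.
rewrite (hP x a) //= linearB bP /= aP g'P -gP.
exact: subrr.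
Qed.

Lemma pdim_le1_of_Ext T :
  (forall I X (p : {linear I -> X}), injective_module I -> surj p ->
    Ext_eq0 1 T X) -> pdim_le1 T.
Proof.
move=> ext; pose d : {linear ker_of (free_cover T) -> dsum T R^o} := val.
have dq : short_exact d (free_cover T).
  split; [exact: val_inj|exact: ker_of_exact|exact: free_cover_surj].
exists (ker_of (free_cover T)), (dsum T R^o), d, (free_cover T); split=> //.
- exact: ker_projective (@dsum_projective _ _) dq ext.
- exact: dsum_projective.
Qed.

Lemma pair_linear_proof A B C (f : {linear A -> C}) (g : {linear B -> C}) :
  linear (fun z : A * B => f z.1 + g z.2).
Proof.
move=> a x y; rewrite /= !linearP scalerDr -!addrA; congr (_ + _).
by rewrite addrCA.
Qed.

Lemma inl_linear_proof A B : linear (fun a : A => (a, 0 : B)).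
Proof. by move=> a x y; congr (_, _); rewrite /= scaler0 addr0. Qed.

Lemma inr_linear_proof A B : linear (fun b : B => (0 : A, b)).
Proof. by move=> a x y; congr (_, _); rewrite /= scaler0 addr0. Qed.

Lemma Ext1_prod A B X :
  Ext_eq0 1 (A * B : lmodType R)%type X <-> Ext_eq0 1 A X /\ Ext_eq0 1 B X.
Proof.
have [I [Q [i [p [Iinj ip]]]]] := injective_embedding_exact X.
rewrite !(Ext1_coresP _ Iinj ip); split=> [lift|[liftA liftB] h].
  split=> h.
    have [h' h'P] := lift (h \o fst).
    exists (h' \o to_linear (@inl_linear_proof A B)) => x; exact: h'P.
  have [h' h'P] := lift (h \o snd).
  by exists (h' \o to_linear (@inr_linear_proof A B)) => x; exact: h'P.
have [f fP] := liftA (h \o to_linear (@inl_linear_proof A B)).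
have [g gP] := liftB (h \o to_linear (@inr_linear_proof A B)).
exists (to_linear (pair_linear_proof f g)) => -[a b] /=.
rewrite linearD fP gP /= -linearD; congr (h (_, _)); rewrite ?addr0 ?add0r //.
Qed.

Lemma retract_summand A B (s : {linear A -> B}) (r : {linear B -> A}) :
  cancel s r -> is_summand A B.
Proof.
move=> sK; exists (ker_of r), (to_linear (pair_linear_proof s val)).
have kerP b : b - s (r b) \in lin_ker r by rewrite inE linearB sK subrr.
exists (fun b => (r b, KerOf (kerP b))) => [[a k]|b] /=; last by rewrite addrC subrK.
have rk : r (val k) = 0 by apply/eqP/(valP k).
have rE : r (s a + val k) = a by rewrite linearD sK rk addr0.
by congr (_, _); [|apply: val_inj]; rewrite /= rE // addrAC subrr add0r.
Qed.

Lemma summand_retract A B : is_summand A B ->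
  exists (s : {linear A -> B}) (r : {linear B -> A}), cancel s r.
Proof.
move=> [K [f [g fK gK]]].
have fs : surj f by move=> b; exists (g b); rewrite gK.
have [z fz|r rP] := surj_lin_factor (q := f) (f := fst) fs.
  by rewrite -(fK z) fz -(linear0 f) fK.
exists (f \o to_linear (@inl_linear_proof A K)), r => a /=.
by rewrite rP.
Qed.

End Dimension.

(** * Character duals of tilting modules *)

Section DirectSumMaps.
Variables (R : pzRingType) (J : choiceType) (T : lmodType R).

Lemma dsum_finite (a : dsum J T) : finite_set [set j | a j <> 0].
Proof. by case: a => a /= /fin_suppP. Qed.

Lemma dsum_single_proof (j : J) (t : T) :
  (fun i => if i == j then t else 0) \in @fin_supp R J T.
Proof.
apply/fin_suppP; apply: (@sub_finite_set _ _ [set j]%classic) => // i /=.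
by case: eqP.
Qed.

Definition dsum_single j t : dsum J T := DSum (dsum_single_proof j t).

Lemma dsum_single_linear j : linear (dsum_single j).
Proof.
move=> a x y; apply/val_inj/funext => i /=.
by rewrite !fctE /=; case: eqP => // _; rewrite scaler0 addr0.
Qed.

HB.instance Definition _ j :=
  GRing.isLinear.Build R T (dsum J T) *:%R (dsum_single j) (dsum_single_linear j).

Definition dsum_eval j (a : dsum J T) : T := a j.

Lemma dsum_eval_linear j : linear (dsum_eval j).
Proof. by []. Qed.

HB.instance Definition _ j :=
  GRing.isLinear.Build R (dsum J T) T *:%R (dsum_eval j) (dsum_eval_linear j).

Lemma dsum_singleK j : cancel (dsum_single j) (dsum_eval j).
Proof. by move=> t; rewrite /dsum_eval /= eqxx. Qed.

Definition dsum_pairing (S : pzRingType) (phi : antihom S R)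
    (chi : J -> char_mod phi T) (a : dsum J T) : QZ :=
  \sum_(j \in [set: J]) cval (chi j) (a j).

Lemma dsum_pairingE (S : pzRingType) (phi : antihom S R)
    (chi : J -> char_mod phi T) (D : set J) (a : dsum J T) :
  finite_set D -> ([set j | a j <> 0] `<=` D)%classic ->
  dsum_pairing chi a = \sum_(j <- fset_set D) cval (chi j) (a j).
Proof.
move=> finD aD; rewrite -fsbig_finite //; apply/esym/fsbig_widen => // j [_ /= Dj].
by have [->|/eqP/aD//] := eqVneq (a j) 0; rewrite raddf0.
Qed.

Lemma dsum_decomposition (a : dsum J T) :
  a = \sum_(j <- fset_set [set j | a j <> 0]%classic) dsum_single j (a j).
Proof.
apply/val_inj/funext => i /=.
rewrite (big_morph (fun b : dsum J T => b i) (id1 := 0) (op1 := +%R)) //=.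
case: (boolP (i \in fset_set [set j | a j <> 0]%classic)) => [ia|ia].
  rewrite (big_fsetD1 i) //= eqxx big_seq big1 ?addr0 // => j.
  by rewrite in_fsetD1 eq_sym => /andP[/negPf-> _].
rewrite big_seq big1 => [|j ja].
  move: ia; rewrite in_fset_set; last exact: dsum_finite.
  by rewrite notin_setE /= => /contrapT.
by case: eqP ja ia => // <- ->.
Qed.

(** The canonical map (T^+)^J -> (T^(J))^+. *)
Lemma dsum_pairing_char (S : pzRingType) (phi : antihom S R) :
  exists g : {linear (J -> char_mod phi T : lmodType S) -> char_mod phi (dsum J T)},
    forall chi a, cval (g chi) a = dsum_pairing chi a.
Proof.
have finU (a b : dsum J T) : finite_set
    ([set j | a j <> 0] `|` [set j | b j <> 0])%classic.
  by rewrite finite_setU; split; apply: dsum_finite.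
apply: char_linear => [chi x y|r chi chi' x].
  rewrite !(dsum_pairingE _ (finU x y)).
  - by rewrite -sumrB; apply: eq_bigr => j _; rewrite -raddfB.
  - by move=> j; right.
  - by move=> j; left.
  move=> j /= xyj; apply: contrapT => /not_orP[] /contrapT xj /contrapT yj.
  by apply: xyj; rewrite !fctE xj yj subrr.
rewrite !(dsum_pairingE _ (dsum_finite x)) //.
  by rewrite -big_split; apply: eq_bigr.
move=> j /= rx xj; apply: rx; by rewrite !fctE xj scaler0.
Qed.

End DirectSumMaps.

Section TiltingDual.
Variable R : pzRingType.

(** Restricting along the coordinates of [r] sends A^+ to (T^+)^J; pairing with T^(J) and then
    dualizing [s] leads back. *)
Lemma retract_dsum_char (J : choiceType) (T A : lmodType R)
    (s : {linear A -> dsum J T}) (r : {linear dsum J T -> A}) : cancel s r ->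
  is_summand (char_mod (of_opp R) A : lmodType R^c)
             (J -> char_mod (of_opp R) T : lmodType R^c).
Proof.
move=> sK; have [g gP] := @dsum_pairing_char R J T _ (of_opp R).
have [s' s'P] := char_dual (of_opp R) s.
have /choice[r' r'P] := fun j => char_dual (of_opp R) (r \o @dsum_single R J T j).
have uL : linear (fun chi => (fun j => r' j chi) : J -> char_mod (of_opp R) T).
  by move=> a x y; apply/funext => j; rewrite linearP.
apply: (@retract_summand _ _ _ (to_linear uL) (s' \o g)) => chi.
apply: charP => a.
rewrite -[LHS]/(cval ((s' \o g) (to_linear uL chi)) a) /= s'P gP.
rewrite (dsum_pairingE _ (dsum_finite (s a))) //.
under eq_bigr do rewrite r'P.
rewrite -raddf_sum /= -linear_sum -(dsum_decomposition (s a)).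
by rewrite sK.
Qed.

Lemma in_Add_char (T A : lmodType R) :
  in_Add T A -> in_Prod (char_mod (of_opp R) T) (char_mod (of_opp R) A).
Proof.
move=> [J /summand_retract[s [r sK]]]; exists J.
(* The index type is arbitrary and receives its choice structure from [{classic J}]. *)
exact: (@retract_dsum_char {classic J} T A s r sK).
Qed.

(** A resolution 0 -> P1 -> P0 -> T -> 0 dualizes to an injective coresolution of T^+. Flipping
    arguments, maps P1 -> M^+ extend to P0 exactly when maps M -> P1^+ lift to P0^+. *)
Lemma Ext1_char_sym (T : lmodType R) (M : lmodType R^c) : pdim_le1 T ->
  Ext_eq0 1 T (char_mod (to_opp R) M) <-> Ext_eq0 1 M (char_mod (of_opp R) T).
Proof.
move=> [P1 [P0 [f [g [P1p P0p [finj fg gs]]]]]].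
have [g' [f' [fg' f'P g'P]]] :=
  char_dual_short_exact (of_opp R) (And3 finj fg gs).
have P0inj := char_projective_injective (@of_oppK R) (@to_oppK R) P0p.
rewrite (Ext1P _ P0p gs fg) (Ext1_coresP _ P0inj fg').
split=> [ext h|lift h _].
  have [h1 h1P] := char_flip (@to_oppK R) h.
  have [x|h2 h2P] := ext h1; first by rewrite -(linear0 f) => /finj ->; rewrite linear0.
  have [h3 h3P] := char_flip (@of_oppK R) h2.
  exists h3 => m; apply: charP => p.
  by rewrite -[LHS]/(cval _ _) f'P h3P -h2P h1P.
have [h1 h1P] := char_flip (@of_oppK R) h.
have [h2 h2P] := lift h1.
have [h3 h3P] := char_flip (@to_oppK R) h2.
exists h3 => p; apply: charP => m.
by rewrite -[RHS]/(cval _ _) h3P -f'P h2P h1P.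
Qed.

Lemma Ext_retract (A X Y : lmodType R) (s : {linear X -> Y}) (r : {linear Y -> X}) k :
  cancel s r -> Ext_eq0 k.+1 A Y -> Ext_eq0 k.+1 A X.
Proof.
move=> sK ext P f fd; have [x|g gP] := ext P (s \o f); first by rewrite /= fd linear0.
by exists (r \o g) => x; rewrite /= -gP /= sK.
Qed.

Lemma tilting_class_cotilting_class n : (1 < n)%N ->
  tilting_class (fun M : lmodType R => FP_Inj n M) ->
  cotilting_class (fun M : lmodType R^c => FP_Flat n M).
Proof.
move=> n1 [T [[Tpd Text [T0 [T1 [f [g [fg T0add T1add]]]]]] TP]].
have flatP M : FP_Flat n M <-> Ext_eq0 1 M (char_mod (of_opp R) T).
  by rewrite FP_Flat_char TP Ext1_char_sym.
(* [T] is a retract of T^(J) for a one-point J. *)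
have Tinj : FP_Inj n T.
  apply/TP; apply: (Ext_retract (@dsum_singleK R unit T tt)).
  exact: Text.
have Cidim : idim_le1 (char_mod (of_opp R) T).
  have [P1 [P0 [u [v [P1p P0p uv]]]]] := Tpd.
  have [v' [u' [vu' _ _]]] := char_dual_short_exact (of_opp R) uv.
  exists (char_mod (of_opp R) P0), (char_mod (of_opp R) P1), v', u'; split=> //;
  exact: (char_projective_injective (@of_oppK R) (@to_oppK R)).
exists (char_mod (of_opp R) T); split; last exact: flatP.
split=> // [[|[|i]] J // _|].
(* Degree 1: T^+ is flat because [T] is FP_n-injective, and products of flat modules are flat by the
   matrix criterion. *)
- exact/flatP/(FP_Flat_fun n1)/FP_Inj_char.
- exact: Ext_idim_le1.
(* The dual of 0 -> R -> T0 -> T1 -> 0 ends in the injective cogenerator R^+. *)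
have [g' [f' [gf' _ _]]] := char_dual_short_exact (of_opp R) fg.
exists (char_mod (of_opp R) R^o), (char_mod (of_opp R) T1), (char_mod (of_opp R) T0).
exists g', f'; split=> //.
- exact: (char_regular_injective (@of_oppK R) (@to_oppK R)).
- exact: (char_regular_cogenerator (@of_oppK R)).
- exact: in_Add_char.
- exact: in_Add_char.
Qed.

End TiltingDual.

(** * From cotilting classes to heredity *)

Section ProjectiveInjective.
Variable R : pzRingType.

Lemma projective_retract (S P : lmodType R) (s : {linear S -> P})
    (r : {linear P -> S}) : cancel s r -> projective P -> projective S.
Proof.
move=> sK Pp A B q f qs; have [g gP] := Pp _ _ q (f \o r) qs.
by exists (g \o s) => x; rewrite /= gP /= sK.
Qed.

(** Ext^2(B/A, C) = 0 makes Ext^1(B, C) -> Ext^1(A, C) surjective; concretely, a map A -> I1 is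
    extended to B, lifted there to I0, and restricted. *)
Lemma Ext1_sub (A B C : lmodType R) (i : {linear A -> B}) :
  injective i -> idim_le1 C -> Ext_eq0 1 B C -> Ext_eq0 1 A C.
Proof.
move=> iinj [I0 [I1 [j [p [I0inj I1inj jp]]]]].
rewrite !(Ext1_coresP _ I0inj jp) => lift h.
have [h1 h1P] := I1inj _ _ i h iinj; have [h2 h2P] := lift h1.
by exists (h2 \o i) => x; rewrite /= h2P h1P.
Qed.

Lemma Ext1_projective (P C : lmodType R) : projective P -> Ext_eq0 1 P C.
Proof.
move=> Pp; have [I [Q [i [p [Iinj ip]]]]] := injective_embedding_exact C.
by apply/(Ext1_coresP _ Iinj ip) => h; case: ip => _ _ ps; apply: Pp.
Qed.

End ProjectiveInjective.

Section FlatHereditary.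
Variable R : pzRingType.

Lemma opp_tr_mul p q r (A : 'M[R]_(p, q)) (B : 'M[R]_(q, r)) :
  opp_tr (A *m B) = opp_tr B *m opp_tr A.
Proof. by apply/matrixP => i j; rewrite !mxE; apply: eq_bigr => k _; rewrite !mxE. Qed.

Lemma mact_row_hom (S : pzRingType) (K : lmodType S) p q r (A : 'M[S]_(p, q))
    (B : 'M[S]_(q, r)) (h : {linear 'rV[S]_r -> K}) i :
  mact A (fun j => h (row j B)) i = h (row i (A *m B)).
Proof.
rewrite row_mul mulmx_sum_row linear_sum /mact; apply: eq_bigr => j _.
by rewrite linearZ mxE.
Qed.

(* Flatness of the right module spanned by the columns of D, applied to these
   columns, makes D von Neumann regular. *)
Lemma flat_columns_regular a b m (X : 'M[R]_(a, m)) (D : 'M[R]_(b, a)) :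
  (forall (K : lmodType R^c) (i : {linear K -> 'rV[R^c]_b}), injective i ->
    mexact K (opp_tr D) (opp_tr X)) ->
  D *m X = 0 -> exists Y : 'M[R]_(a, b), D = D *m Y *m D.
Proof.
move=> flat DX.
(* Columns of [D] are rows of [opp_tr D], so the image of [delta] is the right module that they
   span. *)
pose delta : {linear 'rV[R^c]_a -> 'rV[R^c]_b} := mulmxr (opp_tr D).
have [K [p [i [ps iinj iP]]]] := image_exists delta.
(* The tuple of columns satisfies the compatibility equations because D X = 0; lifting a solution to
   R^a gives the matrix [W]. *)
have [|y yP] := flat K i iinj (fun j => p (row j 1%:M)).
  apply/funext => j; rewrite mact_row_hom mulmx1; apply: iinj.
  rewrite iP linear0 /= -row_mul -opp_tr_mul DX.
  by apply/rowP => k; rewrite !mxE.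
have [w wP] := choice (fun l => ps (y l)).
pose W : 'M[R^c]_(b, a) := \matrix_l w l.
have yE : y = fun l => p (row l W) by apply/funext => l; rewrite rowK wP.
have DE : opp_tr D = opp_tr D *m W *m opp_tr D.
  apply/row_matrixP => j.
  have := congr1 (fun z => i (z j)) yP; rewrite yE /= mact_row_hom !iP /=.
  by rewrite -!row_mul mul1mx => ->.
pose Y : 'M[R]_(a, b) := \matrix_(j, l) W l j.
have WE : W = opp_tr Y by apply/matrixP => l j; rewrite !mxE.
move: DE; rewrite WE -!opp_tr_mul => /matrixP DE.
exists Y; apply/matrixP => l j; have := DE j l.
by rewrite mulmxA !(mxE trmx_key, mxE map_mx_key).
Qed.

Lemma flat_sub_hereditary n : (1 < n)%N ->
  (forall (K M : lmodType R^c) (i : {linear K -> M}),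
    injective i -> FP_Flat n M -> FP_Flat n K) ->
  (forall b, FP_Flat n ('rV[R^c]_b)) ->
  left_n_hereditary R n.
Proof.
case: n => [|[|n]] // n1 flat_sub flat_free P S i Pp [m [q qs]] iinj.
move=> [k [e [d [es /(_ isT) de dP]]]].
have [s sP] := Pp _ _ q idfun qs.
(* As [P] is a retract of R^m, [S] embeds in R^m. Splicing R^(k 0) -> S -> R^m onto the
   (n-1)-presentation of [S] gives an n-presentation of the cokernel. *)
pose k' j := if j is j'.+1 then k j' else m.
pose d' j : {linear 'rV[R]_(k' j.+1) -> 'rV[R]_(k' j)} :=
  match j with 0 => s \o (i \o e) | j'.+1 => d j' end.
have kerd u : s (i (e u)) = 0 -> e u = 0.
  by move=> siu; apply: iinj; rewrite linear0 -[LHS]sP siu linear0.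
have d'P : presentation n.+2 d'.
  case=> [_|j jn]; last exact: dP.
  move=> u; split=> [/kerd/de//|[v <-]].
  by rewrite /= (exact_comp0 v de) !linear0.
have [K j jinj||Y DY] := @flat_columns_regular _ _ _ (lin1_mx (d' 0%N)) (lin1_mx (d' 1%N)).
- by have /(FP_Flat_mexact n1) := flat_sub _ _ j jinj (flat_free _); apply.
- apply/row_matrixP => l.
  rewrite row_mul !mul_rV_lin1 row0.
  by rewrite rowE mul_rV_lin1 (exact_comp0 _ (d'P 0%N isT)).
(* With D the matrix of [d 0], the map u |-> u - u Y D kills the rows of D because D = D Y D, hence
   factors through [e]; it differs from the identity by elements of ker e, so the factor is a
   section. *)
pose E : {linear 'rV[R]_(k 0%N) -> 'rV[R]_(k 0%N)} :=
  idfun \- (d 0%N \o mulmxr Y).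
have [u /de[v <-]|sec secP] := surj_lin_factor (q := e) (f := E) es.
  rewrite /= -!(mul_rV_lin1 (d 0%N)) -!mulmxA (mulmxA _ Y).
  by rewrite -[X in _ *m X]/(lin1_mx (d' 1%N)) {1}DY subrr.
apply: (projective_retract (s := sec) (r := e)); last exact: free_mod_projective.
move=> x.
have [u <-] := es x; rewrite secP /= linearB (exact_comp0 _ de).
exact: subr0.
Qed.

Lemma cotilting_class_hereditary n : (1 < n)%N ->
  cotilting_class (fun M : lmodType R^c => FP_Flat n M) -> left_n_hereditary R n.
Proof.
move=> n1 [C [[Cidim _ _] CP]]; apply: (flat_sub_hereditary n1).
  by move=> K M i iinj /CP MC; apply/CP/(Ext1_sub iinj).
by move=> b; apply/CP/Ext1_projective/free_mod_projective.
Qed.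

End FlatHereditary.

(** * The tilting module of an n-hereditary ring *)

(** This is exactness of Hom(B, X) -> Hom(A, X) -> Ext^1(C, X). *)
Lemma Ext1_extend (R : pzRingType) (A B C X : lmodType R) (f : {linear A -> B})
    (g : {linear B -> C}) (h : {linear A -> X}) :
  short_exact f g -> Ext_eq0 1 C X ->
  exists h' : {linear B -> X}, forall x, h' (f x) = h x.
Proof.
move=> [finj fg gs].
have [I [Q [i [p [Iinj ip]]]]] := injective_embedding_exact X.
move=> /(Ext1_coresP _ Iinj ip) lift; have [iinj ipx ps] := ip.
have [k kP] := Iinj _ _ f (i \o h) finj.
have [b /fg[a <-]|k' k'P] := surj_lin_factor (q := g) (f := p \o k) gs.
  by rewrite /= kP /= (exact_comp0 _ ipx).
have [l lP] := lift k'.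
have [b|h' h'P] := @lift_ker _ _ _ _ i p _ (k \- (l \o g)) iinj ipx.
  by rewrite /= linearB lP k'P subrr.
exists h' => a; apply: iinj; rewrite h'P /= kP /= (exact_comp0 _ fg) linear0.
exact: subr0.
Qed.

Lemma row_hom_comp (R : pzRingType) (X Y : lmodType R) k (f : {linear X -> Y})
    (z : 'I_k -> X) u : f (row_hom z u) = row_hom (f \o z) u.
Proof. by rewrite linear_sum; apply: eq_bigr => i _; rewrite linearZ. Qed.

Section Preenvelope.
Variables (R : pzRingType) (n : nat).
Hypotheses (n1 : (1 < n)%N) (her : left_n_hereditary R n).
Implicit Types I X Y : lmodType R.

(** A type indexing all the systems that test FP_n-injectivity, so that [gen] can adjoin solutions
    to all of them. *)
Record npres := NPres {
  npres_rank : nat -> nat;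
  npres_d : forall i, {linear 'rV[R]_(npres_rank i.+1) -> 'rV[R]_(npres_rank i)};
  npresP : presentation n npres_d }.

Local Notation "''k1' D" := (npres_rank D 1) (at level 10, D at level 9).
Local Notation "''k0' D" := (npres_rank D 0) (at level 10, D at level 9).
Local Notation d0 D := (npres_d D 0).
Local Notation d1 D := (npres_d D 1).

Lemma npres_exact D : exact_at (d1 D) (d0 D).
Proof. exact: npresP. Qed.

(* The image of d0 is projective, so R^k1 splits as this image plus that of d1;
   [proj D] is the resulting projection that kills the image of d1. *)
Lemma npres_proj_exists D :
  exists e : {linear 'rV[R]_('k1 D) -> 'rV[R]_('k1 D)},
    (forall w, e (d1 D w) = 0) /\ (forall u, d0 D (e u) = d0 D u).
Proof.
have [K [p [i [ps iinj iP]]]] := image_exists (d0 D).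
have d1p : exact_at (d1 D) p.
  move=> y; split=> [py|/npres_exact dy].
    by apply/npres_exact; rewrite -iP py linear0.
  by apply: iinj; rewrite iP dy linear0.
have Kp : projective K.
  apply: her (@free_mod_projective R ('k0 D)) _ iinj _.
    by exists ('k0 D), idfun => x; exists x.
  exists (fun j => npres_rank D j.+1), p, (fun j => npres_d D j.+1); split=> //.
  by move=> j jn; apply: npresP; move: jn; case: (n) n1 => [|[|m]].
have [s sP] := Kp _ _ p idfun ps.
exists (s \o p); split=> [w|u] /=; first by rewrite (exact_comp0 _ d1p) linear0.
by rewrite -!iP sP.
Qed.

Definition proj D := projT1 (cid (npres_proj_exists D)).

Lemma proj_d1 D w : proj D (d1 D w) = 0.
Proof. by rewrite /proj; case: cid => e []. Qed.

Lemma d0_proj D u : d0 D (proj D u) = d0 D u.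
Proof. by rewrite /proj; case: cid => e []. Qed.

Definition solvable (X : lmodType R) := forall D, extends_along (d0 D) X.

Lemma FP_Inj_solvable X : FP_Inj n X <-> solvable X.
Proof.
rewrite FP_InjP 1?ltnW //; split=> [h [k d dP]|h k d dP]; first exact: h.
exact: (h (NPres dP)).
Qed.

Lemma hom_proj D (X : lmodType R) (f : {linear 'rV[R]_('k1 D) -> X}) u :
  (forall w, f (d1 D w) = 0) -> f (proj D u) = f u.
Proof.
move=> fd; apply/eqP; rewrite -subr_eq0 -linearB; apply/eqP.
have /npres_exact[w <-] : d0 D (proj D u - u) = 0 by rewrite linearB d0_proj subrr.
exact: fd.
Qed.

(** Precomposing with [proj D] makes any map compatible and leaves compatible maps unchanged. The
    criterion thus bears on all maps, with no condition to preserve. *)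
Lemma solvableP X : solvable X <->
  forall D (f : {linear 'rV[R]_('k1 D) -> X}),
    exists g : {linear 'rV[R]_('k0 D) -> X}, forall u, g (d0 D u) = f (proj D u).
Proof.
split=> [sol D f|sol D f fd].
  have [u /npres_exact[w <-]|g gP] := sol D (f \o proj D).
    by rewrite /= proj_d1 linear0.
  by exists g => u; rewrite -gP.
have [g gP] := sol D f; exists g => u; rewrite gP hom_proj // => w.
by apply: fd; apply: (exact_comp0 _ (@npres_exact D)).
Qed.

Lemma solvable_injective I : injective_module I -> solvable I.
Proof. by move=> Iinj; apply/FP_Inj_solvable => F _; apply: Ext_injective. Qed.

(** A map from R^k1 lifts along [p] by freeness, and by [solvableP] the lift has no compatibility
    condition to meet. *)
Lemma solvable_quotient X Y (p : {linear X -> Y}) : surj p -> solvable X -> solvable Y.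
Proof.
move=> ps /solvableP sol; apply/solvableP => D f.
have [f' f'P] := @free_mod_projective _ _ _ _ p f ps.
have [g gP] := sol D f'; exists (p \o g) => u.
by rewrite /= gP f'P.
Qed.

Lemma solvable_prod X Y : solvable X -> solvable Y -> solvable (X * Y : lmodType R)%type.
Proof.
move=> /solvableP solX /solvableP solY; apply/solvableP => D f.
have [g gP] := solX D (fst \o f); have [h hP] := solY D (snd \o f).
exists ((to_linear (inl_linear_proof (A := X) Y) \o g) \+
        (to_linear (@inr_linear_proof R X Y) \o h)) => u.
by rewrite /= gP hP [RHS]surjective_pairing; congr (_, _); rewrite /= ?addr0 ?add0r.
Qed.

Lemma solvable_dsum (J : Type) X : solvable X -> solvable (dsum J X).
Proof.
move=> /solvableP sol; apply/solvableP => D f.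
have fjL j : linear (fun u => f u j) by move=> a u v; rewrite linearP.
pose fj j := to_linear (fjL j).
(* Only finitely many coordinates of [f] are nonzero; choosing the zero solution for the others
   keeps the support finite. *)
have /choice[g gP] : forall j, exists g : {linear 'rV[R]_('k0 D) -> X},
    (forall u, g (d0 D u) = fj j (proj D u)) /\
    ((forall u, fj j u = 0) -> forall v, g v = 0).
  move=> j; have [f0|nf0] := pselect (forall u, fj j u = 0).
    by exists \0; split=> // u; rewrite f0.
  by have [g gP] := sol D (fj j); exists g.
have finS : finite_set (\bigcup_(i in [set: 'I_('k1 D)])
    [set j | f (delta_mx 0 i) j <> 0])%classic.
  apply: bigcup_finite => // i _; by case: (f _) => a /= /fin_suppP.
have gfin v : (fun j => g j v) \in @fin_supp R J X.
  apply/fin_suppP; apply: sub_finite_set finS => j /= gjv.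
  apply: contrapT => nj; apply: gjv; apply: (gP j).2 => u.
  rewrite row_homE /row_hom big1 // => i _.
  have -> : fj j (delta_mx 0 i) = 0.
    by apply: contrapT => fji; apply: nj; exists i.
  by rewrite scaler0.
have gL : linear (fun v => DSum (gfin v)).
  by move=> a u v; apply/val_inj/funext => j; rewrite /= linearP.
exists (to_linear gL) => u; apply/val_inj/funext => j /=.
by rewrite (gP j).1.
Qed.

(* Base is a free generator; [Op D x] adds the images of the basis of R^k0 under
   an extension along d0 of the map R^k1 -> F given by [x], cut down by [proj D]. *)
Inductive gen : Type :=
| Base
| Op (D : npres) (x : 'I_('k1 D) -> seq (R * gen)) (j : 'I_('k0 D)).

HB.instance Definition _ := gen_eqMixin gen.
HB.instance Definition _ := gen_choiceMixin gen.

Definition free_gen : lmodType R := dsum gen R^o.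

(** Formal combinations are lists because [gen] cannot refer to the free module on itself. *)
Definition comb (l : seq (R * gen)) : free_gen :=
  \sum_(p <- l) p.1 *: dsum_unit R p.2.

Lemma comb_surj (v : free_gen) : exists l, comb l = v.
Proof.
exists [seq (v j : R, j) | j <- fset_set [set j | v j <> 0]%classic].
rewrite /comb big_map /= -[RHS]dsum_lift_eta (dsum_liftE _ (dsum_supp v)) //.
Qed.

(** Killing these elements makes the generators [Op x j] a solution of the system [D] with
    right-hand side [x]. *)
Definition rel D (x : 'I_('k1 D) -> seq (R * gen)) :
    {linear 'rV[R]_('k1 D) -> free_gen} :=
  (row_hom (fun j => dsum_unit R (Op x j)) \o d0 D) \-
  (row_hom (fun i => comb (x i)) \o proj D).

Definition relations (v : free_gen) :=
  forall N : free_gen -> Prop, submodule N ->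
  (forall D (x : 'I_('k1 D) -> seq (R * gen)) u, N (rel x u)) -> N v.

Lemma relations_submodule : submodule relations.
Proof.
split=> [N [N0 _] _//|a v w vN wN N NS rN].
by apply: NS.2; [apply: vN | apply: wN].
Qed.

Variables (T0 : lmodType R) (q0 : {linear free_gen -> T0}).
Hypotheses (q0s : surj q0) (q0P : forall v, q0 v = 0 <-> relations v).

Lemma q0_rel D (x : 'I_('k1 D) -> seq (R * gen)) u : q0 (rel x u) = 0.
Proof. by apply/q0P => N _; apply. Qed.

Section Evaluation.
Variables (X : lmodType R) (x0 : X).
Variable sol : forall D, ('rV[R]_('k1 D) -> X) -> 'I_('k0 D) -> X.
Variable rhs : forall D, ('I_('k1 D) -> seq (R * gen)) -> 'rV[R]_('k1 D) -> X.

(** [rhs] prescribes the value of each relation. [sol] takes a bare function, as its linearity is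
    only established after the recursion. *)
Fixpoint gen_eval (t : gen) : X :=
  match t with
  | Base => x0
  | Op D x j => sol (fun u => rhs x u + row_hom (fun i =>
      foldr (fun p y => p.1 *: gen_eval p.2 + y) 0 (x i)) (proj D u)) j
  end.

Lemma gen_eval_comb (l : seq (R * gen)) :
  dsum_lift gen_eval (comb l) = foldr (fun p y => p.1 *: gen_eval p.2 + y) 0 l.
Proof.
rewrite linear_sum; elim: l => [|p l IHl] /=; first by rewrite big_nil.
by rewrite big_cons IHl linearZ /= dsum_lift_unit.
Qed.

End Evaluation.

(** The relations are triangular: the generators [Op x j] solve a system whose right-hand side
    involves only the generators inside [x]. Solving in [X] recursively realizes any prescribed
    values on the relations and on [Base]. *)
Lemma extend_free X (f : {linear ker_of q0 -> X}) (x0 : X) : solvable X ->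
  exists g : {linear free_gen -> X},
    (forall k : ker_of q0, g (val k) = f k) /\ g (dsum_unit R Base) = x0.
Proof.
move=> Xsol.
have relk D (x : 'I_('k1 D) -> seq (R * gen)) :
    {r : {linear 'rV[R]_('k1 D) -> ker_of q0} | forall u, val (r u) = rel x u}.
  apply: cid; apply: (lift_ker (f := val) _ (ker_of_exact q0)).
    exact: val_inj.
  exact: q0_rel.
pose rhs D x u := f (projT1 (@relk D x) u).
(* A solution is chosen for every function z, with default 0 when z is not linear or does not vanish
   on the image of [d1 D]. *)
have solE D (z : 'rV[R]_('k1 D) -> X) : {y : 'I_('k0 D) -> X |
    linear z -> (forall w, z (d1 D w) = 0) -> forall u, row_hom y (d0 D u) = z u}.
  apply: cid; have [[zL zd]|nz] := pselect (linear z /\ forall w, z (d1 D w) = 0).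
    have [u /npres_exact[w <-]|h hP] := Xsol D (to_linear zL); first exact: zd.
    exists (fun j => h (delta_mx 0 j)) => _ _ u.
    by rewrite -row_homE -hP.
  by exists (fun _ => 0) => zL zd; case: nz.
pose sol D z := projT1 (@solE D z).
have solP D z : linear z -> (forall w, z (d1 D w) = 0) ->
  forall u, row_hom (sol D z) (d0 D u) = z u := projT2 (@solE D z).
pose ev := gen_eval x0 sol rhs; pose g : {linear free_gen -> X} := dsum_lift ev.
exists g; split; last exact: dsum_lift_unit.
have grel D (x : 'I_('k1 D) -> seq (R * gen)) u : g (rel x u) = rhs D x u.
  rewrite /rel /= linearB !(row_hom_comp g).
  have -> : g \o (fun i => comb (x i)) =
      fun i => foldr (fun p y => p.1 *: ev p.2 + y) 0 (x i).
    by apply/funext => i; apply: gen_eval_comb.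
  have -> : g \o (fun j => dsum_unit R (Op x j)) = sol D (fun u => rhs D x u +
      row_hom (fun i => foldr (fun p y => p.1 *: ev p.2 + y) 0 (x i)) (proj D u)).
    by apply/funext => j /=; rewrite dsum_lift_unit.
  rewrite solP.
  - by rewrite addrK.
  - move=> a v w; rewrite /rhs !linearP scalerDr -!addrA; congr (_ + _).
    by rewrite addrCA.
  (* Compatibility: both [proj D] and [d0 D] kill the image of [d1 D], so the relation itself
     vanishes there. *)
  move=> w; rewrite /rhs proj_d1 linear0 addr0.
  suff -> : projT1 (relk D x) (d1 D w) = 0 by rewrite linear0.
  apply: val_inj; rewrite (projT2 (relk D x)) /rel /=.
  by rewrite (exact_comp0 w (@npres_exact D)) proj_d1 !linear0 addr0.
move=> k; have /q0P := eqP (valP k).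
(* The elements of ker q0 on which [g] agrees with [f] form a submodule containing all relations,
   hence all of ker q0. *)
move=> /(_ (fun v => exists k : ker_of q0, val k = v /\ g v = f k)).
case.
- split=> [|a _ _ [k1 [<- gk1]] [k2 [<- gk2]]].
    by exists 0; rewrite !linear0.
  by exists (a *: k1 + k2); rewrite !linearP gk1 gk2.
- move=> D x u; exists (projT1 (relk D x) u).
  by rewrite (projT2 (relk D x)) grel.
by move=> k' [/val_inj -> ].
Qed.

(** Lift the right-hand side to formal combinations [x]; the classes of [Op x j] solve the system by
    construction. *)
Lemma solvable_T0 : solvable T0.
Proof.
apply/solvableP => D f.
have /choice[x xP] : forall i, exists l, q0 (comb l) = f (delta_mx 0 i).
  move=> i; have [v <-] := q0s (f (delta_mx 0 i)); have [l <-] := comb_surj v.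
  by exists l.
exists (row_hom (fun j => q0 (dsum_unit R (Op x j)))) => u.
have /eqP := q0_rel x u; rewrite /rel /= linearB !(row_hom_comp q0) subr_eq0 => /eqP ->.
rewrite [RHS]row_homE; congr row_hom; apply/funext => i; exact: xP.
Qed.

Lemma Ext1_T0 X : solvable X -> Ext_eq0 1 T0 X.
Proof.
move=> Xsol; apply/(Ext1P X (@dsum_projective R gen) q0s (ker_of_exact q0)).
move=> f _; have [g [gP _]] := extend_free f 0 Xsol.
by exists g => k; rewrite -gP.
Qed.

Definition base_map (r : R^o) : T0 := (r : R) *: q0 (dsum_unit R Base).

Lemma base_map_linear : linear base_map.
Proof. by move=> a x y; rewrite /base_map scalerDl scalerA. Qed.

HB.instance Definition _ :=
  GRing.isLinear.Build R R^o T0 *:%R base_map base_map_linear.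

(** An embedding of R in an injective module, which is solvable, factors through [base_map]. *)
Lemma base_map_inj : injective base_map.
Proof.
have [I [i [Iinj iinj]]] := injective_embedding (R^o : lmodType R).
have [g [g0 gB]] := extend_free \0 (i (1 : R)) (solvable_injective Iinj).
have [v v0|h hP] := surj_lin_factor (q := q0) (f := g) q0s.
  have vk : v \in lin_ker q0 by apply/eqP.
  exact: (g0 (KerOf vk)).
have hi r : h (base_map r) = i r.
  rewrite /base_map linearZ hP gB /= -linearZ; congr (i _).
  exact: mulr1.
by move=> r s rs; apply: iinj; rewrite -!hi rs.
Qed.

Variables (T1 : lmodType R) (q1 : {linear T0 -> T1}).
Hypotheses (q1s : surj q1) (q1P : exact_at base_map q1).

(** The kernel of [free_gen] -> [T1] is generated by ker q0 and [Base], and [extend_free] allows the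
    value at [Base] to be prescribed as well. *)
Lemma Ext1_T1 X : solvable X -> Ext_eq0 1 T1 X.
Proof.
move=> Xsol; pose q := q1 \o q0.
have qs : surj q.
  by move=> t; have [s <-] := q1s t; have [v <-] := q0s s; exists v.
apply/(Ext1P X (@dsum_projective R gen) qs (ker_of_exact q)) => f _.
have incE (k : ker_of q0) : val k \in lin_ker q.
  by rewrite inE /q /= (eqP (valP k)) linear0.
have incL : linear (fun k : ker_of q0 => KerOf (incE k)).
  by move=> a x y; apply: val_inj.
have baseE : dsum_unit R Base \in lin_ker q.
  apply/eqP/q1P; exists (1 : R); exact: scale1r.
have [g [gP gB]] := extend_free (f \o to_linear incL) (f (KerOf baseE)) Xsol.
exists g => k; have /q1P[r rE] : q1 (q0 (val k)) = 0 by apply/eqP/(valP k).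
have [k0 kE] : exists k0 : ker_of q0, val k = val k0 + (r : R) *: dsum_unit R Base.
  have k0P : val k - (r : R) *: dsum_unit R Base \in lin_ker q0.
    by rewrite inE linearB linearZ -rE subrr.
  by exists (KerOf k0P); rewrite /= subrK.
have -> : k = KerOf (incE k0) + (r : R) *: KerOf baseE by apply: val_inj.
transitivity (g (val k0) + (r : R) *: g (dsum_unit R Base)).
  by rewrite gP gB linearD linearZ.
by rewrite -linearZ -linearD.
Qed.

Lemma preenvelope_tilting :
  tilting (T0 * T1 : lmodType R)%type /\
  forall X, FP_Inj n X <-> Ext_eq0 1 (T0 * T1 : lmodType R)%type X.
Proof.
have ext X : solvable X -> Ext_eq0 1 (T0 * T1 : lmodType R)%type X.
  by move=> sX; apply/Ext1_prod; split; [apply: Ext1_T0 | apply: Ext1_T1].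
have quot_inj I X (p : {linear I -> X}) : injective_module I -> surj p -> solvable X.
  by move=> Iinj ps; apply: solvable_quotient ps (solvable_injective Iinj).
have sT : solvable (T0 * T1 : lmodType R)%type.
  by apply: solvable_prod; [|apply: solvable_quotient q1s _]; apply: solvable_T0.
have exact01 : short_exact base_map q1 by split=> //; apply: base_map_inj.
split.
  split.
  - by apply: pdim_le1_of_Ext => I X p Iinj ps; apply/ext/(quot_inj I X p).
  - move=> [//|i] J _; apply: (Ext_higher quot_inj ext).
    exact: solvable_dsum.
  exists T0, T1, base_map, q1; split=> //; exists unit.
    pose s : {linear T0 -> dsum unit (T0 * T1 : lmodType R)%type} :=
      dsum_single tt \o to_linear (inl_linear_proof (A := T0) T1).
    pose r : {linear dsum unit (T0 * T1 : lmodType R)%type -> T0} := fst \o dsum_eval tt.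
    apply: (retract_summand (s := s) (r := r)) => x.
    exact: (congr1 fst (dsum_singleK tt (x, 0 : T1))).
  pose s : {linear T1 -> dsum unit (T0 * T1 : lmodType R)%type} :=
    dsum_single tt \o to_linear (@inr_linear_proof R T0 T1).
  pose r : {linear dsum unit (T0 * T1 : lmodType R)%type -> T1} := snd \o dsum_eval tt.
  apply: (retract_summand (s := s) (r := r)) => x.
  exact: (congr1 snd (dsum_singleK tt (0 : T0, x))).
move=> X; rewrite FP_Inj_solvable; split=> [/ext//|/Ext1_prod[_ ext1]].
apply/solvableP => D f.
(* Since Ext^1(T1, X) = 0, the map R -> X picking out the value of [f] on the i-th basis vector
   extends to [T0]. *)
have /choice[h hP] : forall i, exists h : {linear T0 -> X},
    h (base_map (1 : R)) = f (delta_mx 0 i).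
  move=> i; have sL : linear (fun r : R^o => (r : R) *: f (delta_mx 0 i)).
    by move=> a x y; rewrite scalerDl scalerA.
  have [h hP] := Ext1_extend (to_linear sL) exact01 ext1.
  by exists h; rewrite hP /= scale1r.
(* [T0] solves the system for the i-th coordinate of [proj D]; the images of these solutions under
   the [h i] add up to a solution in [X]. *)
have /choice[g gP] : forall i : 'I_('k1 D), exists g : {linear 'rV[R]_('k0 D) -> T0},
    forall u, g (d0 D u) = base_map (proj D u 0 i : R).
  move=> i; have cL : linear (fun u : 'rV[R]_('k1 D) => base_map (u 0 i)).
    by move=> a u v; rewrite !mxE; apply: base_map_linear.
  by have [g gP] := (solvableP T0).1 solvable_T0 D (to_linear cL); exists g.
have gL : linear (fun v => \sum_i h i (g i v)).
  move=> a u v; rewrite scaler_sumr -big_split; apply: eq_bigr => i _.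
  by rewrite !linearP.
exists (to_linear gL) => u /=; rewrite [RHS]row_homE; apply: eq_bigr => i _.
rewrite gP -hP -linearZ; congr (h i _).
by rewrite /base_map scale1r.
Qed.

End Preenvelope.

Lemma hereditary_tilting_class (R : pzRingType) n : (1 < n)%N ->
  left_n_hereditary R n -> tilting_class (fun M : lmodType R => FP_Inj n M).
Proof.
move=> n1 her.
have [T0 [q0 [q0s q0P]]] := quotient_exists (relations_submodule n1 her).
have [T1 [q1 [q1s q1P]]] := coker_exists (base_map q0).
exists (T0 * T1 : lmodType R)%type.
exact: (preenvelope_tilting q0s q0P q1s q1P).
Qed.

Theorem theorem32 (R : pzRingType) (n : nat) (hn : (1 < n)%N) :
  [<-> left_n_hereditary R n;
       tilting_class (fun M : lmodType R => FP_Inj n M);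
       cotilting_class (fun M : lmodType R^c%R => FP_Flat n M)].
Proof.
tfae.
- exact: hereditary_tilting_class.
- exact: tilting_class_cotilting_class.
- exact: cotilting_class_hereditary.
Qed.
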